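(* Let $\mathcal{L}$ be the generator of the North–East model on $\mathbb{Z}^2$ at density $p$, and let $p_c$ be its critical density. If $0\le p<p_c$, then $\operatorname{gap}(\mathcal{L})>0$.
   Context: Let $\Omega=\{0,1\}^{\mathbb{Z}^2}$ (value $1$ = occupied, $0$ = empty), and for $p\in[0,1]$ let $\mu=\bigotimes_{x\in\mathbb{Z}^2}\mu_x$ be the product measure with $\mu_x(1)=p$, $\mu_x(0)=1-p$. For a local function $f:\Omega\to\mathbb{R}$ (depending on finitely many variables), $\mu_x(f)(\eta)$ denotes the average of $f$ over the variable at $x$ with respect to $\mu_x$, the other variables being fixed equal to those of $\eta$. The North–East model at density $p$ is the continuous time Markov process on $\Omega$, reversible with respect to $\mu$, whose generator acts on local functions as $$\mathcal{L}f(\eta)=\sum_{x\in\mathbb{Z}^2}c_x(\eta)[\mu_x(f)(\eta)-f(\eta)],$$ where $c_x(\eta)=1$ if $\eta_{x+\vec e_1}=\eta_{x+\vec e_2}=0$ and $c_x(\eta)=0$ otherwise, with $\vec e_1,\vec e_2$ the Euclidean unit vectors of $\mathbb{Z}^2$. It extends to a non-positive self-adjoint operator on $L^2(\Omega,\mu)$, still denoted $\mathcal{L}$. The critical density is $p_c=\sup\{p\in[0,1):\ 0\text{ is a simple eigenvalue of }\mathcal{L}\}$. The spectral gap is $$\operatorname{gap}(\mathcal{L}):=\inf_{f\in\operatorname{Dom}(\mathcal{L}),\ f\ne\mathrm{const}}\frac{\mathcal{D}(f)}{\operatorname{Var}(f)},\qquad \mathcal{D}(f)=\mu(f\,(-\mathcal{L}f)),$$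 where $\operatorname{Var}(f)=\mu(f^2)-\mu(f)^2$ and ''$f\neq$ const'' is meant in $L^2(\Omega,\mu)$ (the infimum of the empty set being $+\infty$). *)

(* Defs.v *)
From HB Require Import structures.
From mathcomp Require Import all_boot all_order all_algebra.
From mathcomp Require Import all_classical all_reals all_analysis.
From mathcomp Require Import measurable_realfun.
From mathcomp Require Import ring lra.

Set Implicit Arguments.
Unset Strict Implicit.
Unset Printing Implicit Defensive.
Import Order.TTheory GRing.Theory Num.Theory.
Import numFieldNormedType.Exports.

Local Open Scope classical_set_scope.
Local Open Scope ring_scope.

Definition site : Type := (int * int)%type.

(* [true] means occupied, [false] means empty. *)
Definition occupied_sets : set (set (site -> bool)) :=
  [set [set eta : site -> bool | eta x] | x in setT].

Definition Omega := g_sigma_algebraType occupied_sets.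

Section digits.
Context {R : realType} (p : R).

Definition digit_shift (u : R) : R :=
  if u < p then u / p else (u - p) / (1 - p).

Definition digit (n : nat) (u : R) : bool := iter n digit_shift u < p.

(* For u uniform on [0, 1] and 0 <= p <= 1, the bits [digit n u] are
   independent Bernoulli variables of parameter p. *)
Definition config_of_digits (u : measurableTypeR R) : Omega :=
  fun x : site => digit (pickle x) u.

Lemma measurable_digit_shift : measurable_fun setT digit_shift.
Proof.
apply: measurable_fun_ifT.
- exact: measurable_fun_ltr.
- exact: measurable_funM.
- by apply: measurable_funM => //; exact: measurable_realfun.measurable_funB.
Qed.

Lemma measurable_digit n : measurable_fun setT (digit n).
Proof.
apply: measurable_fun_ltr => //.
elim: n => [|n IHn]; first exact: measurable_id.
exact: (measurableT_comp measurable_digit_shift IHn).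
Qed.

Lemma measurable_digit_set n (b : bool) : measurable [set u | digit n u = b].
Proof.
have := measurable_digit n; move/(_ measurableT [set b]); rewrite setTI.
exact.
Qed.

Lemma measurable_config_of_digits : measurable_fun setT config_of_digits.
Proof.
apply: (@measurability _ _ _ _ setT config_of_digits occupied_sets) => //.
move=> _ [_ [x _ <-] <-]; rewrite setTI.
exact: (measurable_digit_set (pickle x) true).
Qed.

HB.instance Definition _ :=
  isMeasurableFun.Build _ _ _ _ config_of_digits measurable_config_of_digits.

End digits.

Definition product_measure {R : realType} (p : R) : probability Omega R :=
  distribution (uniform_prob (@ltr01 R)) (config_of_digits p).

Section product_measure_cylinder.
Context {R : realType} (p : R) (p01 : 0 <= p <= 1).
Local Notation U := (uniform_prob (@ltr01 R)).
Local Notation w := (bernoulli_pmf p).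

Let uniform_prob_itvco (a b : R) : 0 <= a -> a <= b -> b <= 1 ->
  U [set` `[a, b[] = (b - a)%:E.
Proof.
move=> a0 ab b1; rewrite /uniform_prob.
rewrite (eq_integral (cst 1%E)); last first.
  move=> x; rewrite inE/= in_itv/= => /andP[ax xb].
  by rewrite /uniform_pdf (le_trans a0 ax) (le_trans (ltW xb) b1)/= subr0 invr1.
rewrite integral_cst//= mul1e lebesgue_measure_itv/= lte_fin.
case: ltP => [//|ba].
by rewrite (_ : b = a) ?subrr//; apply/eqP; rewrite eq_le ba ab.
Qed.

Let digit_prefix (f : nat -> bool) n : exists2 a : R,
  0 <= a /\ a + \prod_(k < n) w (f k) <= 1 &
  [set u : R | 0 <= u < 1 /\ forall k, (k < n)%N -> digit p k u = f k] =
  [set` `[a, a + \prod_(k < n) w (f k)[].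
Proof.
elim: n f => [|n IHn] f.
  exists 0; rewrite big_ord0 ?add0r//; apply/seteqP; split=> u /=; rewrite in_itv/=.
    by case.
  by move=> ->.
have [a [a0 a1] aE] := IHn (fun k => f k.+1).
rewrite big_ord_recl/=; set q := \prod_(i < n) _ in a1 aE *.
have q0 : 0 <= q by apply: prodr_ge0 => k _; exact: bernoulli_pmf_ge0.
have digitS u : (forall k, (k < n.+1)%N -> digit p k u = f k) <->
    (u < p) = f 0%N /\
    forall k, (k < n)%N -> digit p k (digit_shift p u) = f k.+1.
  split=> [H|[H0 H] [_|k kn]//].
    split=> [|k kn]; first exact: (H 0%N).
    by rewrite -H// /digit iterSr.
  by rewrite -H// /digit iterSr.
have aEP u : (0 <= u < 1 /\ forall k, (k < n)%N -> digit p k u = f k.+1) <->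
    a <= u < a + q.
  have /seteqP[s1 s2] := aE; split=> [/s1|Hu]; first by rewrite /= in_itv.
  by apply: s2; rewrite /= in_itv.
move/andP: p01 => [p0 p1].
case: (f 0%N) digitS => /= digitS.
- have [pe0|pn0] := eqVneq p 0.
    have qE : p * q = 0 by rewrite pe0 mul0r.
    exists 0; first by rewrite qE addr0.
    apply/seteqP; split=> u /=; rewrite in_itv/= qE addr0.
      move=> [/andP[u0 _] /(proj1 (digitS u))[]]; rewrite pe0 => uN.
      by move: (lt_le_trans uN u0); rewrite ltxx.
    by move=> /andP[u0 uN]; move: (lt_le_trans uN u0); rewrite ltxx.
  have pp : 0 < p by rewrite lt_neqAle eq_sym pn0.
  exists (p * a); first by split; nra.
  apply/seteqP; split=> u /=; rewrite in_itv/=.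
    move=> [/andP[u0 _] /(proj1 (digitS u))[up Hu]].
    have : 0 <= u / p < 1 by rewrite divr_ge0//= ltr_pdivrMr// mul1r.
    rewrite /digit_shift up in Hu => up1.
    have := proj1 (aEP _) (conj up1 Hu).
    rewrite ler_pdivlMr// ltr_pdivrMr// => /andP[h1 h2].
    by apply/andP; split; nra.
  move=> /andP[h1 h2].
  have up : u < p by nra.
  have : a <= u / p < a + q.
    by rewrite ler_pdivlMr// ltr_pdivrMr//; apply/andP; split; nra.
  move=> /(proj2 (aEP _))[_ Hu].
  split; first by apply/andP; split; nra.
  by apply (proj2 (digitS u)); split=> //; rewrite /digit_shift up.
- have [pe1|pn1] := eqVneq p 1.
    have qE : (1 - p) * q = 0 by rewrite pe1 subrr mul0r.
    exists 0; first by rewrite qE addr0.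
    apply/seteqP; split=> u /=; rewrite in_itv/= qE addr0.
      by move=> [/andP[_ u1] /(proj1 (digitS u))[]]; rewrite pe1 u1.
    by move=> /andP[u0 uN]; move: (lt_le_trans uN u0); rewrite ltxx.
  have pp : 0 < 1 - p by rewrite subr_gt0 lt_neqAle pn1.
  exists (p + (1 - p) * a); first by split; nra.
  apply/seteqP; split=> u /=; rewrite in_itv/=.
    move=> [/andP[_ u1] /(proj1 (digitS u))[up Hu]].
    move/negbT: (up); rewrite -leNgt => pu.
    have : 0 <= (u - p) / (1 - p) < 1.
      by rewrite divr_ge0 ?subr_ge0//= ?ltW// ltr_pdivrMr// mul1r ltrD2r.
    rewrite /digit_shift up in Hu => up1.
    have := proj1 (aEP _) (conj up1 Hu).
    rewrite ler_pdivlMr// ltr_pdivrMr// => /andP[h1 h2].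
    by apply/andP; split; nra.
  move=> /andP[h1 h2].
  have pu : p <= u by nra.
  have up : (u < p) = false by rewrite ltNge pu.
  have : a <= (u - p) / (1 - p) < a + q.
    by rewrite ler_pdivlMr// ltr_pdivrMr//; apply/andP; split; nra.
  move=> /(proj2 (aEP _))[_ Hu].
  split; first by apply/andP; split; nra.
  by apply (proj2 (digitS u)); split=> //; rewrite /digit_shift up.
Qed.

Let digit_prefix_measure (f : nat -> bool) n :
  U [set u | forall k, (k < n)%N -> digit p k u = f k] =
  (\prod_(k < n) w (f k))%:E.
Proof.
have [a [a0 a1] aE] := digit_prefix f n.
set A := [set u | _].
have mA : measurable A.
  rewrite (_ : A = \bigcap_(k in [set k | (k < n)%N]) [set u | digit p k u = f k]) //.
  by apply: bigcap_measurableType => k _; exact: measurable_digit_set.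
have q0 : 0 <= \prod_(k < n) w (f k).
  by apply: prodr_ge0 => k _; exact: bernoulli_pmf_ge0.
have UI : U [set` `[0, 1[] = 1%E by rewrite uniform_prob_itvco ?subr0.
have AI : A `&` [set` `[0, 1[] = [set` `[a, a + \prod_(k < n) w (f k)[].
  rewrite -aE; apply/seteqP; split=> u /=; rewrite in_itv/= => -[]//.
have U0 : U (A `\` [set` `[0, 1[]) = 0%E.
  apply/eqP; rewrite eq_le measure_ge0 andbT.
  apply: (@le_trans _ _ (U (~` [set` `[0, 1[]))).
    apply: le_measure; rewrite ?inE.
    - exact: measurableD.
    - exact: measurableC.
    - by move=> u [].
  have -> : U (~` [set` `[0, 1[]) = (1 - U [set` `[0%R, 1%R[])%E.
    exact: probability_setC.
  by rewrite UI subee.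
have -> : U A = (U (A `\` [set` `[0%R, 1%R[]) + U (A `&` [set` `[0%R, 1%R[]))%E.
  exact: measureDI.
rewrite U0 add0e AI uniform_prob_itvco// ?lerDl//.
by congr EFin; ring.
Qed.

Let w_opt (b : option bool) : R := if b is Some b then w b else 1.

Let digit_partial (g : nat -> option bool) n j : (j <= n)%N ->
  (forall k, (k < j)%N -> g k != None) ->
  U [set u | forall k b, (k < n)%N -> g k = Some b -> digit p k u = b] =
  (\prod_(k < n) w_opt (g k))%:E.
Proof.
have [m mE] : exists m, (n - j)%N = m by exists (n - j)%N.
elim: m j g mE => [|m IHm] j g mE jn gj.
  have {}jn : j = n by apply/eqP; rewrite eqn_leq jn -subn_eq0 mE eqxx.
  rewrite {}jn in gj => {mE}.
  rewrite (eq_bigr (fun k : 'I_n => w (odflt true (g k)))); last first.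
    by move=> k _; have := gj k (ltn_ord k); case: (g k).
  rewrite -(digit_prefix_measure (fun k => odflt true (g k))).
  congr (U _); apply/seteqP; split=> u /= H k.
    by move=> kn; apply: H => //; have := gj k kn; case: (g k).
  by move=> b kn gk; rewrite H// gk.
have jltn : (j < n)%N by rewrite -subn_gt0 mE.
have mS : (n - j.+1)%N = m by rewrite subnS mE.
case gjE : (g j) => [b|].
  apply: (IHm j.+1) => // k; rewrite ltnS leq_eqVlt => /predU1P[->|/gj//].
  by rewrite gjE.
pose g' b k := if k == j then Some b else g k.
have IH b : U [set u | forall k c, (k < n)%N -> g' b k = Some c -> digit p k u = c] =
    (\prod_(k < n) w_opt (g' b k))%:E.
  apply: (IHm j.+1) => // k; rewrite ltnS leq_eqVlt /g' => /predU1P[->|kj].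
    by rewrite eqxx.
  by case: (k == j) => //; exact: gj.
have prodE b : \prod_(k < n) w_opt (g' b k) = w b * \prod_(k < n) w_opt (g k).
  rewrite (bigD1 (Ordinal jltn))//= [in RHS](bigD1 (Ordinal jltn))//= gjE /= mul1r.
  rewrite /g' eqxx /=; congr (_ * _); apply: eq_bigr => k kj.
  by case: eqP => // kjE; move: kj; rewrite -val_eqE/= kjE eqxx.
have mS' h : measurable [set u | forall k c, (k < n)%N -> h k = Some c -> digit p k u = c].
  rewrite [X in measurable X](_ : _ = \bigcap_(k in [set k | (k < n)%N])
     (if h k is Some c then [set u | digit p k u = c] else setT)).
    apply: bigcap_measurableType => k _; case: (h k) => // c.
    exact: measurable_digit_set.
  apply/seteqP; split=> u /= H k.
    by move=> /= kn; case hk : (h k) => [c|//]; exact: H.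
  by move=> c kn hk; have := H k kn; rewrite hk.
pose C b := [set u | forall k c, (k < n)%N -> g' b k = Some c -> digit p k u = c].
rewrite [X in U X](_ : _ = C true `|` C false).
  have CI : C true `&` C false = set0.
    apply/seteqP; split=> u //= -[H1 H2].
    have := H1 j true jltn; have := H2 j false jltn; rewrite /g' eqxx.
    by move=> ->// /(_ erefl).
  have -> : U (C true `|` C false) = (U (C true) + U (C false))%E.
    by apply: measureU => //; exact: mS'.
  rewrite (IH true) (IH false) !prodE -EFinD.
  by congr EFin; rewrite /bernoulli_pmf/=; ring.
apply/seteqP; split=> u /=.
  move=> H; case uj : (digit p j u); [left|right] => k c kn; rewrite /g'.
    by case: eqP => [->[<-]//|_]; exact: H.
  by case: eqP => [->[<-]//|_]; exact: H.
by move=> [] H k c kn gk; apply: (H k) => //; rewrite /g';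
  case: eqP => // kj; move: gk; rewrite kj gjE.
Qed.

(* This determines [product_measure p]: the sets below, together with the
   empty set, are stable under intersection and generate the sigma-algebra. *)
Lemma product_measure_cylinder (s : seq site) (eta : site -> bool) : uniq s ->
  product_measure p [set omega : Omega | forall x, x \in s -> omega x = eta x] =
  (\prod_(x <- s) bernoulli_pmf p (eta x))%:E.
Proof.
move=> us.
pose g k := obind (fun x : site => if (x \in s) && (pickle x == k) then Some (eta x) else None)
   (unpickle k).
pose n := (\max_(x <- s) pickle x).+1.
have gP x : x \in s -> g (pickle x) = Some (eta x).
  by move=> xs; rewrite /g pickleK /= xs eqxx.
have gN k b : g k = Some b -> exists x, [/\ x \in s, pickle x = k & eta x = b].
  rewrite /g; case: (unpickle k) => [x|//] /=.
  by case: ifP => // /andP[xs /eqP xk] [<-]; exists x.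
have sn x : x \in s -> (pickle x < n)%N.
  by move=> xs; rewrite ltnS; exact: leq_bigmax_seq.
transitivity (U [set u | forall k b, (k < n)%N -> g k = Some b -> digit p k u = b]).
  congr (U _); apply/seteqP; split=> u /= H.
    by move=> k b _ /gN[x [xs <- <-]]; exact: H.
  by move=> x xs; apply: H (sn x xs) (gP x xs).
rewrite (@digit_partial g n 0)//; congr EFin.
have -> : \prod_(x <- s) w (eta x) = \prod_(x <- s) w_opt (g (pickle x)).
  by apply: eq_big_seq => x xs; rewrite gP.
rewrite -[RHS](big_map pickle xpredT (fun k => w_opt (g k))).
have -> : \prod_(k < n) w_opt (g k) = \prod_(k <- iota 0 n) w_opt (g k).
  by rewrite -[n in iota 0 n]subn0 -/(index_iota 0 n) big_mkord.
rewrite (bigID (mem (map pickle s))) /= [X in _ * X]big1 ?mulr1; last first.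
  move=> k kN; case gk : (g k) => [b|//]; move: kN.
  by have [x [xs <- _]] := gN _ _ gk; rewrite map_f.
rewrite -big_filter; apply: perm_big; apply: uniq_perm.
- by apply: filter_uniq; exact: (iota_uniq 0 n).
- by rewrite map_inj_uniq//; exact: (pcan_inj pickleK).
move=> k; rewrite mem_filter -[_ :: _]/(iota 0 n) mem_iota/= add0n.
by apply: andb_idr => /mapP[x xs ->]; exact: sn.
Qed.

End product_measure_cylinder.

Section north_east.
Context {R : realType} (p : R).
Local Notation mu := (product_measure p).

Definition depends_on (s : seq site) (f : Omega -> R) :=
  forall eta eta' : Omega, {in s, eta =1 eta'} -> f eta = f eta'.

Definition local_function (f : Omega -> R) := exists s, depends_on s f.

Definition update (eta : Omega) (x : site) (b : bool) : Omega :=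
  fun y => if y == x then b else eta y.

Definition site_mean (x : site) (f : Omega -> R) (eta : Omega) : R :=
  \sum_(b : bool) bernoulli_pmf p b * f (update eta x b).

Definition constraint (x : site) (eta : Omega) : bool :=
  ~~ eta (x.1 + 1, x.2) && ~~ eta (x.1, x.2 + 1).

(* The sum has finite support when f is local, see [local_generatorE];
   [\sum_(x \in _)] is 0 by convention on other inputs. *)
Definition local_generator (f : Omega -> R) (eta : Omega) : R :=
  \sum_(x \in [set: site]) (constraint x eta)%:R * (site_mean x f eta - f eta).

Lemma local_generatorE (s : seq site) (f : Omega -> R) (eta : Omega) :
  uniq s -> depends_on s f ->
  local_generator f eta =
  \sum_(x <- s) (constraint x eta)%:R * (site_mean x f eta - f eta).
Proof.
move=> us sf; rewrite /local_generator.
rewrite [RHS]fsbig_seq//; apply: esym; apply: fsbig_widen => // x [_ /= /negP xs].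
have fE b : f (update eta x b) = f eta.
  apply: sf => y ys; rewrite /update.
  by case: eqP => // yx; move: xs; rewrite -yx ys.
rewrite /site_mean big_bool/= !fE /bernoulli_pmf/= -mulrDl subrKC mul1r.
by rewrite subrr mulr0.
Qed.

(* Graph of the self-adjoint extension of [local_generator] to L^2(mu), up to
   almost everywhere equality. Since local functions form a core, the operator
   on them is essentially self-adjoint and this extension is its L^2 closure. *)
Definition generator (f g : Omega -> R) : Prop :=
  [/\ f \in Lfun mu 2%:E, g \in Lfun mu 2%:E &
    exists u : nat -> Omega -> R,
      [/\ forall n, local_function (u n),
          'N[mu]_2%:E[EFin \o (u n \- f)%R]%E @[n --> \oo] --> 0%E &
          'N[mu]_2%:E[EFin \o (local_generator (u n) \- g)%R]%E
            @[n --> \oo] --> 0%E]].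

Definition simple_eigenvalue (lambda : R) : Prop :=
  exists f : Omega -> R,
    [/\ generator f (fun eta => lambda * f eta),
        ~ {ae mu, forall eta, f eta = 0} &
        forall g, generator g (fun eta => lambda * g eta) ->
          exists c : R, {ae mu, forall eta, g eta = c * f eta}].

(* D(f) with g standing for L f. *)
Definition dirichlet_form (f g : Omega -> R) : R :=
  \int[mu]_eta (f eta * - g eta).

Definition var (f : Omega -> R) : R :=
  \int[mu]_eta (f eta ^+ 2) - (\int[mu]_eta f eta) ^+ 2.

Definition ae_constant (f : Omega -> R) : Prop :=
  exists c : R, {ae mu, forall eta, f eta = c}.

Definition spectral_gap : \bar R :=
  ereal_inf [set (dirichlet_form fg.1 fg.2 / var fg.1)%:E | fg in
    [set fg : (Omega -> R) * (Omega -> R) |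
      generator fg.1 fg.2 /\ ~ ae_constant fg.1]].

End north_east.

Definition critical_density (R : realType) : R :=
  sup [set p : R | 0 <= p < 1 /\ simple_eigenvalue p 0].

(* Main.v *)
Require Import Defs.
From HB Require Import structures.
From mathcomp Require Import all_boot all_order all_algebra.
From mathcomp Require Import all_classical all_reals all_analysis.
From mathcomp Require Import measurable_realfun.
From mathcomp Require Import ring lra zify.

Set Implicit Arguments.
Unset Strict Implicit.
Unset Printing Implicit Defensive.
Import Order.TTheory GRing.Theory Num.Theory.
Import numFieldNormedType.Exports.
Local Open Scope ring_scope.

(* The theorem reduces to a Poincare inequality
   [Var f <= C * sum_x mu (c_x Var_x f)] for local [f].  If [0] is a simple
   eigenvalue at some density [s > p], there is no infinite occupied north-east
   path at density [s]: otherwise the indicator of the event that such a path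
   starts from the origin would be a nonconstant function in the kernel of the
   generator.  By the sharpness argument of Duminil-Copin and Tassion, the
   probability [theta p n] of an occupied path of [n] steps then decays
   exponentially at [p < s].  Relax the constraint at [x] to the event that no
   occupied path of [n] steps starts next to [x].  For [n] large this event is so
   likely that the relaxed dynamics satisfies a Poincare inequality, by the
   method of Martinelli and Toninelli, and a relaxed move is a bounded number of
   legal moves, which compares its Dirichlet form with the original one. *)

(** * Averages over finitely many sites *)

(** Constants always lie in the kernel, so simplicity of [0] says that the kernel contains nothing
    else. The generator is a graph closure, so placing the percolation indicator in the kernel
    requires local approximations [u n] whose images tend to 0 in L^2; the decrements of [theta]
    control that norm. Absence of percolation alone is too weak for the Poincare step: the error of
    the relaxed constraint is [theta p n] times the size of its range, of order [n ^ 2]. This is why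
    a larger density [s] and a decay rate enter. The decay comes from a dichotomy at [p]: either
    some finite set has an expected number of exits below 1, and [theta p] contracts geometrically,
    or all have at least 1, and a differential inequality keeps [theta s] away from 0. Orientation
    is used throughout: a relaxed constraint at [x] reads only sites after [x] in lexicographic
    order, and the two pieces of a path cut at a site read disjoint sets of variables. *)

Lemma update_update (eta : Omega) x b c : update (update eta x b) x c = update eta x c.
Proof. by apply/funext => y; rewrite /update; case: eqP. Qed.

Lemma updateC (eta : Omega) x y b c : x != y ->
  update (update eta x b) y c = update (update eta y c) x b.
Proof.
move=> xy; apply/funext => z; rewrite /update.
by have [->|//] := eqVneq z y; rewrite eq_sym (negbTE xy).
Qed.

Lemma update_eq (eta : Omega) x b : update eta x b x = b.
Proof. by rewrite /update eqxx. Qed.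

Lemma update_neq (eta : Omega) x b y : y != x -> update eta x b y = eta y.
Proof. by rewrite /update; case: eqP. Qed.

Definition agree_off (s : seq site) (eta eta' : Omega) :=
  forall x, x \notin s -> eta x = eta' x.

Lemma agree_off_update s (eta : Omega) x b : x \in s ->
  agree_off s eta (update eta x b).
Proof.
move=> xs y ys; rewrite update_neq//.
by apply: contraNneq ys => ->.
Qed.

Lemma agree_off_sub s t eta eta' : {subset s <= t} ->
  agree_off s eta eta' -> agree_off t eta eta'.
Proof. by move=> st H x xt; apply: H; apply: contraNN xt => /st. Qed.

Lemma agree_off_trans s eta1 eta2 eta3 :
  agree_off s eta1 eta2 -> agree_off s eta2 eta3 -> agree_off s eta1 eta3.
Proof. by move=> H1 H2 x xs; rewrite H1// H2. Qed.

(** Complementary to [depends_on]: it also makes sense for functions of infinitely many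
    variables. *)
Definition free_of {T : Type} (s : seq site) (f : Omega -> T) :=
  forall eta eta', agree_off s eta eta' -> f eta = f eta'.

Lemma free_of_sub T s t (f : Omega -> T) :
  {subset s <= t} -> free_of t f -> free_of s f.
Proof. by move=> st Hf eta eta' H; apply: Hf; exact: agree_off_sub H. Qed.

Lemma free_of_update T s (f : Omega -> T) x b eta :
  free_of s f -> x \in s -> f (update eta x b) = f eta.
Proof. by move=> Hf xs; apply/esym/Hf; exact: agree_off_update. Qed.

Lemma free_of1P T x (f : Omega -> T) :
  (forall eta b, f (update eta x b) = f eta) -> free_of [:: x] f.
Proof.
move=> H eta eta' e; suff -> : eta' = update eta x (eta' x) by rewrite H.
apply/funext => y; rewrite /update; case: eqP => [->//|/eqP yx].
by rewrite e// inE.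
Qed.

Lemma depends_on_free (R : realType) s t (f : Omega -> R) :
  depends_on s f -> (forall x, x \in s -> x \notin t) -> free_of t f.
Proof. by move=> sf st eta eta' e; apply: sf => x /st /e. Qed.

Section averages.
Context {R : realType} (p : R).
Implicit Types (f g : Omega -> R) (s t : seq site) (eta : Omega).

Lemma site_meanE x f eta :
  site_mean p x f eta = p * f (update eta x true) + (1 - p) * f (update eta x false).
Proof. by rewrite /site_mean big_bool. Qed.

(** This is the conditional expectation given the variables off [s]. Being a finite iterated sum, it
    applies to any [f] without measurability; repetitions in [s] are harmless because [site_mean] is
    idempotent. *)
Definition avg s f : Omega -> R := foldr (site_mean p) f s.

Lemma avg_cons x s f : avg (x :: s) f = site_mean p x (avg s f).
Proof. by []. Qed.

Lemma avg_cat s t f : avg (s ++ t) f = avg s (avg t f).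
Proof. by rewrite /avg foldr_cat. Qed.

Lemma site_meanC x y f :
  site_mean p x (site_mean p y f) = site_mean p y (site_mean p x f).
Proof.
have [->//|xy] := eqVneq x y.
apply/funext => eta; rewrite !site_meanE !(updateC _ _ _ xy); ring.
Qed.

Lemma site_mean_idem x f : site_mean p x (site_mean p x f) = site_mean p x f.
Proof. apply/funext => eta; rewrite !site_meanE !update_update; ring. Qed.

Lemma site_mean_avg x s f :
  site_mean p x (avg s f) = avg s (site_mean p x f).
Proof. by elim: s => //= y s IH; rewrite site_meanC IH. Qed.

Lemma avgC s t f : avg s (avg t f) = avg t (avg s f).
Proof. by elim: s => //= x s ->; rewrite site_mean_avg. Qed.

Lemma site_mean_absorb x s f : x \in s -> site_mean p x (avg s f) = avg s f.
Proof.
elim: s => //= y s IH; rewrite inE => /predU1P[->|xs].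
  by rewrite site_mean_idem.
by rewrite site_meanC IH.
Qed.

Lemma avg_absorb s t f : {subset s <= t} -> avg s (avg t f) = avg t f.
Proof.
elim: s => //= x s IH st; rewrite IH ?site_mean_absorb//.
  by apply: st; rewrite inE eqxx.
by move=> y ys; apply: st; rewrite inE ys orbT.
Qed.

Lemma eq_avg_mem s t f : s =i t -> avg s f = avg t f.
Proof.
move=> st; rewrite -(@avg_absorb s t) => [|x]; last by rewrite st.
by rewrite avgC avg_absorb// => x; rewrite st.
Qed.

Lemma avg_absorbr s t f : {subset s <= t} -> avg t (avg s f) = avg t f.
Proof. by move=> st; rewrite avgC avg_absorb. Qed.

Lemma avg_filterC (P : pred site) s f :
  avg s f = avg [seq x <- s | P x] (avg [seq x <- s | ~~ P x] f).
Proof.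
rewrite -avg_cat; apply: eq_avg_mem => x; rewrite mem_cat !mem_filter.
by case: (P x); rewrite ?orbF.
Qed.

Lemma free_site_mean x s f : free_of s f -> free_of s (site_mean p x f).
Proof.
move=> Hf eta eta' e; rewrite !site_meanE.
by congr (_ * _ + _ * _); apply: Hf => y /e; rewrite /update => ->.
Qed.

Lemma free_avg s t f : free_of s f -> free_of s (avg t f).
Proof. by move=> Hf; elim: t => //= x t; exact: free_site_mean. Qed.

Lemma site_mean_free x f : free_of [:: x] f -> site_mean p x f = f.
Proof.
move=> H; apply/funext => eta; rewrite site_meanE.
by rewrite !(free_of_update _ _ H) ?inE//; ring.
Qed.

Lemma avg_free s f : free_of s f -> avg s f = f.
Proof.
elim: s => //= x s IH H; rewrite IH ?site_mean_free//.
  by apply: free_of_sub H => y; rewrite inE => /eqP ->; rewrite inE eqxx.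
by apply: free_of_sub H => y ys; rewrite inE ys orbT.
Qed.

Lemma avg_is_free s f : free_of s (avg s f).
Proof.
elim: s f => [|x s IH] f eta eta' e.
  by rewrite (_ : eta = eta')//; apply/funext => x; exact: e.
rewrite /= !site_meanE.
suff H b : avg s f (update eta x b) = avg s f (update eta' x b) by rewrite !H.
apply: IH => y ys; rewrite /update; case: eqP => // /eqP yx.
by apply: e; rewrite inE (negbTE yx).
Qed.

Lemma site_mean_ext x f g eta :
  (forall b, f (update eta x b) = g (update eta x b)) ->
  site_mean p x f eta = site_mean p x g eta.
Proof. by move=> H; rewrite !site_meanE !H. Qed.

Lemma eq_avg_at s f g eta :
  (forall eta', agree_off s eta eta' -> f eta' = g eta') ->
  avg s f eta = avg s g eta.
Proof.
elim: s eta => [|x s IH] eta H; first exact: H.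
apply: site_mean_ext => b; apply: IH => eta' e.
apply: H; apply: (@agree_off_trans _ _ (update eta x b)).
  by apply: agree_off_update; rewrite inE eqxx.
by apply: agree_off_sub e => y ys; rewrite inE ys orbT.
Qed.

Lemma eq_avg s f g : f =1 g -> avg s f =1 avg s g.
Proof. by move=> H eta; apply: eq_avg_at => *; exact: H. Qed.

Lemma avgD s f g eta :
  avg s (fun e => f e + g e) eta = avg s f eta + avg s g eta.
Proof.
elim: s eta => //= x s IH eta; rewrite !site_meanE !IH; ring.
Qed.

Lemma avgZ s (a : R) f eta : avg s (fun e => a * f e) eta = a * avg s f eta.
Proof. elim: s eta => //= x s IH eta; rewrite !site_meanE !IH; ring. Qed.

Lemma avgN s f eta : avg s (fun e => - f e) eta = - avg s f eta.
Proof. elim: s eta => //= x s IH eta; rewrite !site_meanE !IH; ring. Qed.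

Lemma avgB s f g eta :
  avg s (fun e => f e - g e) eta = avg s f eta - avg s g eta.
Proof. by rewrite avgD avgN. Qed.

Lemma avg_cst s (a : R) eta : avg s (fun=> a) eta = a.
Proof. elim: s eta => //= x s IH eta; rewrite !site_meanE !IH; ring. Qed.

Lemma avg_sum (I : Type) (r : seq I) (P : pred I) (F : I -> Omega -> R) s eta :
  avg s (fun e => \sum_(i <- r | P i) F i e) eta = \sum_(i <- r | P i) avg s (F i) eta.
Proof.
elim: r => [|i r IH].
  by rewrite big_nil -[RHS](avg_cst s 0 eta); apply: eq_avg => e; rewrite big_nil.
rewrite big_cons; case: ifP => Pi; rewrite -IH -?avgD; apply: eq_avg => e;
  by rewrite big_cons Pi.
Qed.

Lemma avg_mull s f g eta : free_of s f ->
  avg s (fun e => f e * g e) eta = f eta * avg s g eta.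
Proof.
by move=> H; rewrite -avgZ; apply: eq_avg_at => eta' /H ->.
Qed.

(** Independence: within [s], [f] reads only sites off [P] and [g] only sites in [P], so one block
    is integrated out while the other factor is frozen. *)
Lemma avg_indep s f g eta (P : pred site) :
  free_of [seq x <- s | P x] f -> free_of [seq x <- s | ~~ P x] g ->
  avg s (fun e => f e * g e) eta = avg s f eta * avg s g eta.
Proof.
move=> ff gf.
rewrite (avg_filterC P) [in X in _ = X * _](avg_filterC P) [in X in _ = _ * X](avg_filterC P).
set A := [seq x <- s | P x]; set B := [seq x <- s | ~~ P x].
have -> : avg A (avg B f) = avg B f.
  by rewrite avg_free//; exact: free_avg.
rewrite (@avg_free B g)// avgC.
have -> : avg A (fun e => f e * g e) = (fun e => avg A g e * f e).
  apply/funext => e; rewrite mulrC -avg_mull//.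
rewrite avg_mull; last exact: free_avg.
by rewrite mulrC.
Qed.

Hypothesis p01 : 0 <= p <= 1.

Lemma le_avg_at s f g eta :
  (forall eta', agree_off s eta eta' -> f eta' <= g eta') ->
  avg s f eta <= avg s g eta.
Proof.
move: p01 => /andP[p0 p1].
elim: s eta => [|x s IH] eta H; first exact: H.
rewrite /= !site_meanE.
have K b : avg s f (update eta x b) <= avg s g (update eta x b).
  apply: IH => eta' e.
  apply: H; apply: (@agree_off_trans _ _ (update eta x b)).
    by apply: agree_off_update; rewrite inE eqxx.
  by apply: agree_off_sub e => y ys; rewrite inE ys orbT.
by rewrite lerD// ler_wpM2l// subr_ge0.
Qed.

Lemma le_avg s f g eta : (forall e, f e <= g e) -> avg s f eta <= avg s g eta.
Proof. by move=> H; apply: le_avg_at => *; exact: H. Qed.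

Lemma le_avg_absorb s t f g eta : {subset s <= t} ->
  (forall e, avg s f e <= avg s g e) -> avg t f eta <= avg t g eta.
Proof.
move=> st H; rewrite -(@avg_absorbr s t f)// -(@avg_absorbr s t g)//.
exact: le_avg.
Qed.

Lemma avg_ge0 s f eta : (forall e, 0 <= f e) -> 0 <= avg s f eta.
Proof. by move=> H; rewrite -(avg_cst s 0 eta); exact: le_avg. Qed.

Lemma avg_cauchy_schwarz s f g eta :
  avg s (fun e => f e * g e) eta ^+ 2 <=
  avg s (fun e => f e ^+ 2) eta * avg s (fun e => g e ^+ 2) eta.
Proof.
set A := avg s (fun e => f e ^+ 2) eta; set B := avg s (fun e => f e * g e) eta.
set C := avg s (fun e => g e ^+ 2) eta.
have H (t : R) : 0 <= A - 2 * t * B + t ^+ 2 * C.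
  have -> : A - 2 * t * B + t ^+ 2 * C = avg s (fun e => (f e - t * g e) ^+ 2) eta.
    rewrite /A /B /C -!avgZ -avgB -avgD.
    by apply: eq_avg => e; ring.
  by apply: avg_ge0 => e; exact: sqr_ge0.
have A0 : 0 <= A by apply: avg_ge0 => e; exact: sqr_ge0.
have C0 : 0 <= C by apply: avg_ge0 => e; exact: sqr_ge0.
have [CE|Cn0] := eqVneq C 0.
  have [->|Bn0] := eqVneq B 0; first by rewrite CE expr0n/= mulr0.
  (* With [C = 0] the quadratic is affine in [t]; this [t] gives it the value -1. *)
  have := H ((A + 1) / (2 * B)); rewrite CE mulr0 addr0.
  have -> : 2 * ((A + 1) / (2 * B)) * B = A + 1 by field.
  lra.
have := H (B / C).
have -> : A - 2 * (B / C) * B + (B / C) ^+ 2 * C = (A * C - B ^+ 2) / C by field.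
by rewrite pmulr_lge0 ?invr_gt0 ?lt_def ?Cn0// subr_ge0.
Qed.

Lemma avg_jensen s f eta : avg s f eta ^+ 2 <= avg s (fun e => f e ^+ 2) eta.
Proof.
have := avg_cauchy_schwarz s f (fun=> 1) eta.
rewrite (@eq_avg s (fun=> 1 ^+ 2) (fun=> 1)); last by move=> e; rewrite expr1n.
rewrite avg_cst mulr1.
by rewrite (@eq_avg s (fun e => f e * 1) f)// => e; rewrite mulr1.
Qed.

End averages.

(** * Conditional variances *)

Section variances.
Context {R : realType} (p : R).
Implicit Types (f g : Omega -> R) (s t : seq site) (eta : Omega).
Local Notation avg := (avg p).

Definition grad x f eta := f (update eta x true) - f (update eta x false).

(** The variance in the variable at [x], written through the difference of the two values so that it
    is visibly the square of a linear expression in [f]; [site_varE] gives the usual form. *)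
Definition site_var x f eta := p * (1 - p) * grad x f eta ^+ 2.

Definition avg_var s f eta := avg s (fun e => f e ^+ 2) eta - avg s f eta ^+ 2.

Lemma site_varE x f eta : site_var x f eta =
  site_mean p x (fun e => f e ^+ 2) eta - site_mean p x f eta ^+ 2.
Proof. rewrite /site_var /grad !site_meanE; ring. Qed.

Lemma grad_avg x s f eta : x \notin s -> grad x (avg s f) eta = avg s (grad x f) eta.
Proof.
elim: s eta => //= y s IH eta; rewrite inE negb_or => /andP[xy xs].
rewrite site_meanE -!IH// /grad !site_meanE !(updateC _ _ _ xy); ring.
Qed.

Lemma grad_free x f eta : free_of [:: x] f -> grad x f eta = 0.
Proof. by move=> H; rewrite /grad !(free_of_update _ _ H) ?inE// subrr. Qed.

Lemma free_grad x f : free_of [:: x] (grad x f).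
Proof. by apply: free_of1P => eta b; rewrite /grad !update_update. Qed.

Lemma site_var_free x f eta : free_of [:: x] f -> site_var x f eta = 0.
Proof. by move=> H; rewrite /site_var grad_free// expr0n/= mulr0. Qed.

(** Law of total variance, with [s] integrated out before [x]. *)
Lemma avg_var_cons x s f eta : avg_var (x :: s) f eta =
  site_mean p x (avg_var s f) eta + site_var x (avg s f) eta.
Proof. rewrite site_varE /avg_var /= !site_meanE; ring. Qed.

Hypothesis p01 : 0 <= p <= 1.

Lemma pq_ge0 : 0 <= p * (1 - p).
Proof. by move: p01 => /andP[? ?]; rewrite mulr_ge0// subr_ge0. Qed.

Lemma site_var_ge0 x f eta : 0 <= site_var x f eta.
Proof. by rewrite mulr_ge0 ?pq_ge0 ?sqr_ge0. Qed.

(** Convexity of the variance: [grad x] commutes with averages over other sites, and Jensen's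
    inequality applies to its square. *)
Lemma site_var_avg x s f eta :
  site_var x (avg s f) eta <= avg s (site_var x f) eta.
Proof.
have [xs|xs] := boolP (x \in s).
  rewrite site_var_free; first by apply: avg_ge0 => // e; exact: site_var_ge0.
  apply: free_of_sub (@avg_is_free _ p s f) => y.
  by rewrite inE => /eqP ->.
rewrite /site_var grad_avg// avgZ ler_wpM2l ?pq_ge0//.
exact: avg_jensen.
Qed.

Lemma site_varD_le x f g eta :
  site_var x (fun e => f e + g e) eta <= 2 * site_var x f eta + 2 * site_var x g eta.
Proof.
have := pq_ge0; rewrite /site_var /grad; set c := p * (1 - p) => c0.
set a := f _; set b := g _; set a' := f _; set b' := g _.
have : 0 <= c * ((a - a') - (b - b')) ^+ 2 by rewrite mulr_ge0// sqr_ge0.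
by move=> H; rewrite -subr_ge0; apply: le_trans H _; rewrite le_eqVlt; apply/orP; left; apply/eqP; ring.
Qed.

Lemma site_var_le_mean_sqr x f eta :
  site_var x f eta <= site_mean p x (fun e => f e ^+ 2) eta.
Proof. by rewrite site_varE gerBl sqr_ge0. Qed.

End variances.

(** * Poincare inequality with unlikely violated constraints *)

(** Lexicographic order. It extends the north-east order, so the sites that a constraint at [x]
    inspects all come after [x]. *)
Definition before (x y : site) := (x.1 < y.1) || (x.1 == y.1) && (x.2 < y.2).

Lemma before_irr x : before x x = false.
Proof. by rewrite /before !ltxx andbF. Qed.

Lemma before_trans : transitive before.
Proof. by move=> [y1 y2] [x1 x2] [z1 z2]; rewrite /before/=; lia. Qed.

Lemma before_total x y : [|| x == y, before x y | before y x].
Proof. by case: x y => [x1 x2] [y1 y2]; rewrite /before/= xpair_eqE; lia. Qed.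

Lemma before_asym x y : before x y -> before y x = false.
Proof. by case: x y => [x1 x2] [y1 y2]; rewrite /before/=; lia. Qed.

Lemma before_add (x v : site) : before 0 v -> before x (x + v).
Proof. by case: x v => [x1 x2] [v1 v2]; rewrite /before/=; lia. Qed.

Lemma lex_sorted (s : seq site) : exists2 t : seq site, t =i s & pairwise before t.
Proof.
exists (sort (fun x y => ~~ before y x) (undup s)).
  by move=> x; rewrite mem_sort mem_undup.
set t := sort _ _.
have ut : uniq t by rewrite sort_uniq undup_uniq.
have : pairwise (fun x y => ~~ before y x) t.
  rewrite -sorted_pairwise ?sort_sorted//.
  - move=> x y; have := before_total x y; case: (boolP (before y x)) => [/before_asym ->|]//=.
  - move=> [y1 y2] [x1 x2] [z1 z2]; rewrite /before/=; lia.
elim: t ut => //= x t IH /andP[xt ut] /andP[xa tp]; rewrite IH// andbT.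
apply/allP => y yt; have := allP xa y yt; have := before_total x y.
by case: eqP xt => [->|_ _]; rewrite ?yt//; case: (before y x); rewrite ?orbF.
Qed.

Lemma pairwise_before_uniq s : pairwise before s -> uniq s.
Proof.
elim: s => //= x s IH /andP[/allP xs /IH ->]; rewrite andbT.
by apply/negP => /xs; rewrite before_irr.
Qed.

Definition after (s : seq site) x := [seq y <- s | before x y].

Lemma sum_uniq_subset {R : realType} (V : site -> R) (s t : seq site) :
  uniq s -> uniq t -> {subset s <= t} -> (forall x, 0 <= V x) ->
  \sum_(x <- s) V x <= \sum_(x <- t) V x.
Proof.
move=> us ut st V0.
rewrite [leRHS](bigID (mem s))/= -[leLHS]addr0 lerD ?sumr_ge0//.
rewrite -[leRHS]big_filter le_eqVlt; apply/orP; left; apply/eqP; apply: perm_big.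
apply: uniq_perm => //; first exact: filter_uniq.
by move=> x; rewrite mem_filter; apply/esym/andb_idr/st.
Qed.

Lemma sum_uniq_support {R : realType} (V : site -> R) (s t : seq site) :
  uniq s -> uniq t -> {subset s <= t} -> (forall x, x \notin s -> V x = 0) ->
  \sum_(x <- t) V x = \sum_(x <- s) V x.
Proof.
move=> us ut st V0.
rewrite (bigID (mem s))/= [X in _ + X]big1 ?addr0//.
rewrite -[LHS]big_filter; apply: perm_big.
apply: uniq_perm => //; first exact: filter_uniq.
by move=> x; rewrite mem_filter; apply/andb_idr/st.
Qed.

Section constrained_poincare.
Context {R : realType} (p : R) (p01 : 0 <= p <= 1).
Implicit Types (f g : Omega -> R) (s t : seq site) (eta : Omega).
Local Notation avg := (avg p).
Local Notation avg_var := (avg_var p).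
Local Notation site_var := (site_var p).

Lemma eq_avg_var_mem s t f : s =i t -> avg_var s f = avg_var t f.
Proof. by move=> st; apply/funext => e; rewrite /avg_var !(eq_avg_mem _ _ st). Qed.

Lemma avg_varE s f eta : avg_var s f eta = avg s (fun e => (f e - avg s f e) ^+ 2) eta.
Proof.
transitivity (avg s (fun e => f e ^+ 2 - 2 * avg s f eta * f e + avg s f eta ^+ 2) eta).
  rewrite (@avgD _ _ _ (fun e => f e ^+ 2 - 2 * avg s f eta * f e)) avgB avgZ avg_cst.
  by rewrite /avg_var; ring.
apply: eq_avg_at => e /(@avg_is_free _ p s f) <-; ring.
Qed.

Lemma avg_var_ge0 s f eta : 0 <= avg_var s f eta.
Proof. by rewrite avg_varE; apply: avg_ge0 => // e; exact: sqr_ge0. Qed.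

Lemma avg_avg_var s f eta : avg s (avg_var s f) eta = avg_var s f eta.
Proof.
rewrite avg_free// => e e' H; rewrite /avg_var.
by rewrite (@avg_is_free _ p s _ _ _ H) (@avg_is_free _ p s f _ _ H).
Qed.

(** Martingale decomposition: the law of total variance is iterated along the order, later sites
    being integrated out first. *)
Lemma avg_var_chain s t f eta : pairwise before s -> {subset s <= t} ->
  avg t (avg_var s f) eta =
  \sum_(x <- s) avg t (site_var x (avg (after s x) f)) eta.
Proof.
elim: s => [|x s IH].
  move=> _ _; rewrite big_nil -[RHS](avg_cst p t 0 eta).
  by apply: eq_avg => e; rewrite /avg_var/= subrr.
rewrite pairwise_cons => /andP[/allP xs ps] st; rewrite big_cons.
have -> : after (x :: s) x = s.
  by rewrite /after/= before_irr; apply/all_filterP/allP.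
rewrite (eq_big_seq (fun y => avg t (site_var y (avg (after s y) f)) eta)); last first.
  by move=> y ys; rewrite /after/= (before_asym (xs _ ys)).
rewrite -IH//; last by move=> y ys; apply: st; rewrite inE ys orbT.
rewrite (@eq_avg _ _ _ _ _ (fun e => avg_var_cons p x s f e)) avgD addrC.
congr (_ + _).
rewrite -[site_mean _ _ _]/(avg [:: x] (avg_var s f)) avg_absorbr// => y.
by rewrite inE => /eqP ->; apply: st; rewrite inE eqxx.
Qed.

Lemma site_var_add_free x f g : free_of [:: x] g ->
  site_var x (fun e => f e + g e) = site_var x f.
Proof.
move=> H; apply/funext => e; rewrite /site_var; congr (_ * _ ^+ 2).
by rewrite /grad !(free_of_update _ _ H) ?inE//; ring.
Qed.

Lemma site_var_mul_bool x (c : Omega -> bool) f eta : free_of [:: x] c ->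
  site_var x (fun e => (c e)%:R * f e) eta = (c eta)%:R * site_var x f eta.
Proof.
move=> H; rewrite /site_var /grad !(free_of_update _ _ H) ?inE//.
by case: (c eta) => /=; ring.
Qed.

Variables (c : site -> Omega -> bool) (D : seq site) (delta : R).
Hypothesis uD : uniq D.
Hypothesis before_D : forall v, v \in D -> before 0 v.
Local Notation nbhd x := [seq x + v | v <- D].
Hypothesis cD : forall x eta eta', {in nbhd x, eta =1 eta'} -> c x eta = c x eta'.
Hypothesis c_delta : forall x eta, avg (nbhd x) (fun e => (~~ c x e)%:R) eta <= delta.

Lemma free_of_constraint x s : (forall y, y \in nbhd x -> y \notin s) -> free_of s (c x).
Proof. by move=> H e e' ee; apply: cD => y /H /ee. Qed.

(* Each increment of the martingale obtained by integrating out the sites in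
   decreasing order splits according to whether the constraint holds.  On the
   bad event [f] may be replaced by its fluctuation around an average that does
   not see [x], so that Cauchy-Schwarz gains the factor [delta]. *)
Lemma site_var_after M f x eta : pairwise before M ->
  x \in M -> {subset nbhd x <= M} ->
  let V z := avg M (site_var z (avg (after M z) f)) eta in
  (V x <= 2 * avg M (fun e => (c x e)%:R * site_var x f e) eta
       + 2 * delta * \sum_(v <- 0 :: D) V (x + v) : Prop).
Proof.
move=> pM xM DM V.
set Dx := nbhd x; set B := after M x.
have DxB y : y \in Dx -> y \in B.
  move=> yD; rewrite mem_filter DM// andbT.
  by case/mapP: yD => v /before_D v0 ->; exact: before_add.
have xB : x \notin B by rewrite mem_filter before_irr.
have xDx : x \notin Dx by apply: contraNN xB => /DxB.
(* Later sites that the constraint does not read are integrated out once and for all, which leaves a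
   function [h] to be averaged over [Dx]. *)
set rest := [seq y <- B | y \notin Dx]; set h := avg rest f.
have Bh : avg B f = avg Dx h.
  rewrite /h -avg_cat; apply: eq_avg_mem => y.
  by rewrite mem_cat [y \in rest]mem_filter; have := DxB y; case: (y \in Dx) => //= ->.
have cx : free_of [:: x] (c x).
  by apply: free_of_constraint => y yD; rewrite inE; apply: contraNneq xDx => <-.
have crest : free_of rest (c x).
  by apply: free_of_constraint => y yD; rewrite mem_filter negb_and negbK yD.
set g := avg (x :: Dx) h.
have gfree : free_of (x :: Dx) g by exact: avg_is_free.
have gx : free_of [:: x] g.
  by apply: free_of_sub gfree => y; rewrite !inE => ->.
have gDx : free_of Dx g.
  by apply: free_of_sub gfree => y; rewrite !inE orbC => ->.
(* The average of [h] over [Dx] is [a + b + k]: the good event, the fluctuation around [g] on the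
   bad event, and the contribution of [g] on the bad event. The last one does not see [x] and drops
   out of the variance. *)
pose a := avg Dx (fun e => (c x e)%:R * h e).
pose b := avg Dx (fun e => (~~ c x e)%:R * (h e - g e)).
pose k e := g e * avg Dx (fun e => (~~ c x e)%:R) e.
have kx : free_of [:: x] k.
  move=> e e' ee; rewrite /k (gx _ _ ee); congr (_ * _).
  by apply: free_avg ee => u u' /cx ->.
have BE : avg B f = (fun e => a e + b e + k e).
  rewrite Bh; apply/funext => e.
  rewrite /a /b /k -avg_mull// -!avgD.
  by apply: eq_avg => u; case: (c x u) => /=; ring.
have RM : {subset rest <= M} by move=> y; rewrite !mem_filter => /and3P[].
have Ha e : site_var x a e <= avg (Dx ++ rest) (fun e => (c x e)%:R * site_var x f e) e.
  apply: le_trans (site_var_avg p01 _ _ _ _) _.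
  rewrite avg_cat; apply: le_avg => // u.
  rewrite site_var_mul_bool// avg_mull; last by move=> w w' /crest ->.
  by rewrite ler_wpM2l ?ler0n// site_var_avg.
have Hb e : site_var x b e <= delta * avg_var (x :: Dx) h e.
  apply: le_trans (site_var_le_mean_sqr _ _ _ _) _.
  rewrite avg_varE -/g avg_cons -[site_mean p x _ e]/(avg [:: x] _ e).
  rewrite -[site_mean p x _ e]/(avg [:: x] _ e) -avgZ.
  apply: le_avg => // u.
  apply: le_trans (avg_cauchy_schwarz p01 _ _ _ _) _.
  apply: ler_wpM2r; first by apply: avg_ge0 => // w; exact: sqr_ge0.
  rewrite (@eq_avg _ _ _ _ (fun e => (~~ c x e)%:R)); first exact: c_delta.
  by move=> w; case: (c x w); rewrite ?expr0n ?expr1n.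
have d0 : 0 <= delta.
  by apply: le_trans (c_delta x eta); apply: avg_ge0 => // e; rewrite ler0n.
apply: (@le_trans _ _ (2 * avg M (fun e => (c x e)%:R * site_var x f e) eta
      + 2 * (delta * avg M (avg_var (x :: Dx) h) eta))).
- rewrite /V -/B BE site_var_add_free//.
  apply: (@le_trans _ _ (avg M (fun e => 2 * site_var x a e + 2 * site_var x b e) eta)).
    by apply: le_avg => // e; exact: site_varD_le.
  rewrite avgD; apply: lerD; rewrite avgZ ler_pM2l//.
    have -> : avg M (fun e => (c x e)%:R * site_var x f e) =
      avg M (avg (Dx ++ rest) (fun e => (c x e)%:R * site_var x f e)).
      rewrite avg_absorbr// => y; rewrite mem_cat => /orP[/DxB|/RM//].
      by rewrite mem_filter => /andP[].
    exact: le_avg.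
  by rewrite -avgZ; exact: le_avg.
- rewrite lerD2l -mulrA ler_pM2l// ler_wpM2l//.
  (* [A] lists [x :: Dx] in the order of [M], so that its variance expands along [avg_var_chain]. *)
  pose A := [seq z <- M | z \in x :: Dx].
  have AE : A =i x :: Dx.
    move=> z; rewrite mem_filter; apply: andb_idr.
    by rewrite inE => /predU1P[->//|/DM].
  rewrite -(eq_avg_var_mem _ AE) avg_var_chain; last 2 first.
  + exact: pairwise_filter.
  + by move=> z; rewrite mem_filter => /andP[].
  have -> : \sum_(v <- 0 :: D) V (x + v) = \sum_(z <- A) V z.
    rewrite -(big_map (fun v => x + v) xpredT V) /= addr0.
    apply: perm_big; apply: uniq_perm.
    + rewrite /= xDx map_inj_uniq//; exact: addrI.
    + by apply: filter_uniq; exact: pairwise_before_uniq.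
    + by move=> z; rewrite AE.
  rewrite big_seq [leRHS]big_seq; apply: ler_sum => z zA.
  have -> : avg (after A z) h = avg rest (avg (after M z) f).
    rewrite /h -!avg_cat; apply: eq_avg_mem => y; rewrite !mem_cat.
    rewrite /after [y \in rest]mem_filter !mem_filter.
    have [zy|] := boolP (before z y); last by rewrite /= ?andbF ?orbF.
    have [yM|] := boolP (y \in M); last by rewrite /= ?andbF ?orbF.
    have xy : before x y.
      move: zA; rewrite AE inE => /predU1P[<-//|/DxB].
      by rewrite mem_filter => /andP[xz _]; exact: before_trans zy.
    by rewrite xy inE /= !andbT orbT; case: (y \in Dx); rewrite ?orbT.
  rewrite /V -[in leRHS](avg_absorbr _ _ RM).
  by apply: le_avg => // e; exact: site_var_avg.
Qed.

(** Summing the one-site bound over [x] counts each increment at most once per vector of [0 :: D];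
    the resulting multiple of the variance is moved to the left-hand side. *)
Theorem constrained_poincare M s f eta : uniq s -> depends_on s f ->
  {subset s <= M} -> {in s, forall x, {subset nbhd x <= M}} ->
  (1 - 2 * delta * (size D).+1%:R) * avg_var M f eta <=
  2 * \sum_(x <- s) avg M (fun e => (c x e)%:R * site_var x f e) eta.
Proof.
move=> us fs sM DM.
have [M' M'E pM'] := lex_sorted M.
rewrite -(eq_avg_var_mem _ M'E).
rewrite (eq_bigr (fun x => avg M' (fun e => (c x e)%:R * site_var x f e) eta)); last first.
  by move=> x _; rewrite (eq_avg_mem _ _ M'E).
have {}sM : {subset s <= M'} by move=> x /sM; rewrite M'E.
have {}DM : {in s, forall x, {subset nbhd x <= M'}}.
  by move=> x /DM H y /H; rewrite M'E.
have uM' := pairwise_before_uniq pM'.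
pose V z := avg M' (site_var z (avg (after M' z) f)) eta.
have V0 z : 0 <= V z by apply: avg_ge0 => // e; exact: site_var_ge0.
have Vs z : z \notin s -> V z = 0.
  move=> zs; rewrite /V -[RHS](avg_cst p M' 0 eta); apply: eq_avg => e.
  apply: site_var_free; apply: free_avg; apply: depends_on_free fs _ => y ys.
  by rewrite inE; apply: contraNneq zs => <-.
have varE : avg_var M' f eta = \sum_(x <- s) V x.
  by rewrite -avg_avg_var avg_var_chain// (sum_uniq_support us uM').
have d0 : 0 <= delta.
  by apply: le_trans (c_delta 0 eta); apply: avg_ge0 => // e; rewrite ler0n.
have key : \sum_(x <- s) V x <=
   2 * \sum_(x <- s) avg M' (fun e => (c x e)%:R * site_var x f e) eta +
   2 * delta * \sum_(x <- s) \sum_(v <- 0 :: D) V (x + v).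
  rewrite !mulr_sumr -big_split/= big_seq [leRHS]big_seq; apply: ler_sum => x xs.
  by apply: site_var_after => //; [exact: sM|exact: DM].
have shifts : \sum_(x <- s) \sum_(v <- 0 :: D) V (x + v) <=
    (size D).+1%:R * \sum_(x <- s) V x.
  rewrite exchange_big/= -[in leRHS]varE.
  have -> : (size D).+1%:R * avg_var M' f eta = \sum_(v <- 0 :: D) avg_var M' f eta.
    by rewrite big_const_seq count_predT iter_addr_0 mulr_natl.
  rewrite big_seq [leRHS]big_seq; apply: ler_sum => v vD.
  rewrite varE -(sum_uniq_support us uM' sM Vs).
  rewrite -(big_map (fun x => x + v) xpredT V); apply: sum_uniq_subset => //.
    by rewrite map_inj_uniq//; exact: addIr.
  move=> _ /mapP[x xs ->]; move: vD; rewrite inE => /predU1P[->|vD].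
    by rewrite addr0; exact: sM.
  by apply: (DM _ xs); exact: map_f.
rewrite mulrBl mul1r lerBlDr varE; apply: le_trans key _.
by rewrite lerD2l -!mulrA ler_pM2l// ler_wpM2l.
Qed.

End constrained_poincare.

(** * North-east paths and relaxed constraints *)

Definition right_of (x : site) : site := (x.1 + 1, x.2).
Definition up_of (x : site) : site := (x.1, x.2 + 1).

(* [iter k (path_step S eta) T x] holds when a north-east path of [k] steps leads
   from [x] to [T], all its sites but the last one being occupied and in [S]. *)
Definition path_step (S : pred site) (eta : Omega) (T : pred site) : pred site :=
  fun x => [&& S x, eta x & T (right_of x) || T (up_of x)].

(** The target is [eta] itself, so the last site is occupied too: [n] steps, [n.+1] occupied
    sites. *)
Definition conn (n : nat) (eta : Omega) (x : site) : bool :=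
  iter n (path_step predT eta) eta x.

Lemma connS n eta x :
  conn n.+1 eta x = eta x && (conn n eta (right_of x) || conn n eta (up_of x)).
Proof. by []. Qed.

Lemma conn_occupied n eta x : conn n eta x -> eta x.
Proof. by case: n => // n; rewrite connS => /andP[]. Qed.

Lemma eq_conn n (eta eta' : Omega) (x : site) :
  (forall y : site, x.1 <= y.1 -> x.2 <= y.2 -> y.1 + y.2 <= x.1 + x.2 + n%:Z ->
    eta y = eta' y) ->
  conn n eta x = conn n eta' x.
Proof.
elim: n x => [|n IH] x H; first by apply: (H x); lia.
rewrite !connS; congr andb; first by apply: (H x); lia.
congr (_ || _); apply: IH => y /= *; apply: H; lia.
Qed.

(** [n = 0] gives back [constraint]; larger [n] asks for less. *)
Definition unblocked n (x : site) (eta : Omega) :=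
  ~~ conn n eta (right_of x) && ~~ conn n eta (up_of x).

Lemma unblockedS n x eta : unblocked n.+1 x eta =
  (~~ eta (right_of x) || unblocked n (right_of x) eta) &&
  (~~ eta (up_of x) || unblocked n (up_of x) eta).
Proof. by rewrite /unblocked !connS !negb_and !negb_or. Qed.

Lemma free_of_unblocked n (x : site) (s : seq site) :
  (forall y : site, y \in s -> y.1 < x.1 \/ y.2 < x.2 \/ y = x) ->
  free_of s (unblocked n x).
Proof.
move=> H e e' ee; rewrite /unblocked; congr (~~ _ && ~~ _); apply: eq_conn => y /= h1 h2 _;
  by apply: ee; apply/negP => /H; case: y h1 h2 => y1 y2 /= h1 h2 [|[|yx]]; try lia;
    move: h1 h2; rewrite -yx/=; lia.
Qed.

Lemma site_neq (x y : site) : (x.1 < y.1) || (x.2 < y.2) -> x != y.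
Proof. by apply: contraTneq => ->; rewrite !ltxx. Qed.

Section unblocked_moves.
Context {R : realType} (p : R) (p0 : 0 <= p) (p1 : p < 1).
Implicit Types (f : Omega -> R) (s M : seq site) (eta : Omega).
Local Notation avg := (avg p).
Local Notation site_var := (site_var p).

Let p01 : 0 <= p <= 1. Proof. by rewrite p0 ltW. Qed.

(* Flipping [x] when [a] can be emptied first: compare [f] along the moves that
   empty [a], flip [x] and restore [a]. *)
Lemma site_var_via x a f (G H : Omega -> bool) M eta : x != a ->
  free_of [:: x; a] G -> free_of [:: x; a] H -> x \in M -> a \in M ->
  (1 - p) * avg M (fun e => ((~~ e a || G e) && H e)%:R * site_var x f e) eta <=
  3 * (avg M (fun e => (~~ e a && H e)%:R * site_var x f e) eta +
       avg M (fun e => (G e)%:R * site_var a f e) eta).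
Proof.
move=> xa fG fH xM aM.
have sM : {subset [:: x; a] <= M} by move=> y; rewrite !inE => /orP[/eqP->|/eqP->].
rewrite -avgD -!avgZ; apply: (le_avg_absorb p01 _ sM) => e.
have GE b c : G (update (update e x b) a c) = G e.
  by rewrite !(free_of_update _ _ fG)// !inE eqxx ?orbT.
have HE b c : H (update (update e x b) a c) = H e.
  by rewrite !(free_of_update _ _ fH)// !inE eqxx ?orbT.
have ax : a != x by rewrite eq_sym.
have xE b c : site_var x f (update (update e x b) a c) =
    p * (1 - p) * (f (update (update e x true) a c) - f (update (update e x false) a c)) ^+ 2.
  by rewrite /site_var /grad !(updateC _ _ _ ax) !update_update.
have aE b c : site_var a f (update (update e x b) a c) =
    p * (1 - p) * (f (update (update e x b) a true) - f (update (update e x b) a false)) ^+ 2.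
  by rewrite /site_var /grad !update_update.
rewrite /= !site_meanE !GE !HE !xE !aE !update_eq.
set F11 := f (update (update e x true) a true).
set F01 := f (update (update e x false) a true).
set F10 := f (update (update e x true) a false).
set F00 := f (update (update e x false) a false).
have q0 : 0 <= 1 - p by rewrite subr_ge0 ltW.
have c0 : 0 <= p * (1 - p) by exact: mulr_ge0.
set A := p * (1 - p) * (F11 - F10) ^+ 2; set B := p * (1 - p) * (F01 - F00) ^+ 2.
set C := p * (1 - p) * (F10 - F00) ^+ 2; set D := p * (1 - p) * (F11 - F01) ^+ 2.
have [A0 B0 C0 D0] : [/\ 0 <= A, 0 <= B, 0 <= C & 0 <= D].
  by split; rewrite mulr_ge0 ?sqr_ge0 //.
(* The difference [F11 - F01] is a sum of three increments, through [F10] and [F00], whence the 3.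
   It is weighted by [p] ([a] occupied) while [B] and [C] are available with weight [1 - p] ([a]
   empty); the factor [1 - p] in the statement compensates. *)
have DABC : D <= 3 * (A + B + C).
  have H1 : 0 <= p * (1 - p) * ((F11 - F10 - (F10 - F00)) ^+ 2 +
     (F11 - F10 + (F01 - F00)) ^+ 2 + (F10 - F00 + (F01 - F00)) ^+ 2).
    by rewrite mulr_ge0 ?addr_ge0 ?sqr_ge0.
  by move: H1; rewrite /A /B /C /D; lra.
clearbody A B C D.
have H1 : 0 <= (1 - p) * p * (3 * (A + B + C) - D) by rewrite mulr_ge0 ?mulr_ge0 // subr_ge0.
have H2 : 0 <= p * p * A by do ?apply: mulr_ge0.
have H3 : 0 <= (1 - p) * (1 - p) * B by do ?apply: mulr_ge0.
have H4 : 0 <= (1 - p) * (1 - p) * C by do ?apply: mulr_ge0.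
have H5 : 0 <= p * A by do ?apply: mulr_ge0.
have H6 : 0 <= (1 - p) * B by do ?apply: mulr_ge0.
have H7 : 0 <= (1 - p) * C by do ?apply: mulr_ge0.
have H8 : 0 <= p * ((1 - p) * C) by do ?apply: mulr_ge0.
by case: (G e); case: (H e) => /=; lra.
Qed.

Lemma right_of_inj : injective right_of.
Proof. by move=> [a b] [c d] [/addIr -> ->]. Qed.

Lemma up_of_inj : injective up_of.
Proof. by move=> [a b] [c d] [-> /addIr ->]. Qed.

Lemma sum_shift_le (V : site -> R) (h : site -> site) s : uniq s -> injective h ->
  (forall x, 0 <= V x) -> (forall x, x \notin s -> V x = 0) ->
  \sum_(x <- s) V (h x) <= \sum_(x <- s) V x.
Proof.
move=> us hI V0 Vs; rewrite -(big_map h xpredT V).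
rewrite -(@sum_uniq_support _ V s (undup (s ++ map h s)))// ?undup_uniq//; last first.
  by move=> x xs; rewrite mem_undup mem_cat xs.
apply: sum_uniq_subset; rewrite ?undup_uniq ?map_inj_uniq//.
by move=> x xs; rewrite mem_undup mem_cat xs orbT.
Qed.

(** By [unblockedS] each neighbour of [x] is empty or can be emptied by a move relaxed at order [n].
    Two uses of [site_var_via] empty them in turn, each at the price [3 / (1 - p)]. *)
Lemma unblocked_step n f (x : site) M eta :
  x \in M -> right_of x \in M -> up_of x \in M ->
  let T m y := avg M (fun e => (unblocked m y e)%:R * site_var y f e) eta in
  (T n.+1 x <= (3 / (1 - p)) ^+ 2 * (T 0%N x + T n (right_of x) + T n (up_of x)) : Prop).
Proof.
move=> xM aM bM T.
have T0 m y : 0 <= T m y.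
  by apply: avg_ge0 => // e; rewrite mulr_ge0 ?ler0n ?site_var_ge0.
have q0 : 0 < 1 - p by rewrite subr_gt0.
have := @site_var_via x (right_of x) f (unblocked n (right_of x))
  (fun e => ~~ e (up_of x) || unblocked n (up_of x) e) M eta.
have := @site_var_via x (up_of x) f (unblocked n (up_of x))
  (fun e => ~~ e (right_of x)) M eta.
have n1 : x != up_of x by apply: site_neq => /=; lia.
have n2 : x != right_of x by apply: site_neq => /=; lia.
have n3 : up_of x != right_of x by apply: site_neq => /=; lia.
have n4 : right_of x != up_of x by rewrite eq_sym.
have f1 : free_of [:: x; up_of x] (unblocked n (up_of x)).
  by apply: free_of_unblocked => y; rewrite !inE => /orP[]/eqP -> /=; [lia|tauto].
have f2 : free_of [:: x; right_of x] (unblocked n (right_of x)).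
  by apply: free_of_unblocked => y; rewrite !inE => /orP[]/eqP -> /=; [lia|tauto].
have f3 : free_of [:: x; up_of x] (fun e : Omega => ~~ e (right_of x)).
  by move=> e e' ee; rewrite ee// !inE negb_or eq_sym n2.
have f4 : free_of [:: x; right_of x]
    (fun e => ~~ e (up_of x) || unblocked n (up_of x) e).
  move=> e e' ee; rewrite (ee (up_of x)) ?inE ?negb_or 1?eq_sym ?n1//.
  congr (_ || _); apply: free_of_unblocked ee => y; rewrite !inE.
  by move=> /orP[]/eqP -> /=; lia.
move=> /(_ n1 f1 f3 xM bM) H1 /(_ n2 f2 f4 xM aM).
rewrite -/(T n (right_of x)) -/(T n (up_of x)) in H1 *.
have -> : avg M (fun e => ((~~ e (right_of x) || unblocked n (right_of x) e) &&
   (~~ e (up_of x) || unblocked n (up_of x) e))%:R * site_var x f e) eta = T n.+1 x.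
  by apply: eq_avg => e; rewrite unblockedS.
set Z := avg M _ eta => H2.
have ZE : avg M (fun e => ((~~ e (up_of x) || unblocked n (up_of x) e) &&
    ~~ e (right_of x))%:R * site_var x f e) eta = Z.
  by apply: eq_avg => e; rewrite andbC.
have TE : avg M (fun e => (~~ e (up_of x) && ~~ e (right_of x))%:R * site_var x f e) eta =
    T 0%N x.
  by apply: eq_avg => e; rewrite andbC.
rewrite ZE TE in H1.
have C1 : 1 <= 3 / (1 - p) by rewrite ler_pdivlMr// mul1r; move: p0; lra.
have K1 : Z <= 3 / (1 - p) * (T 0%N x + T n (up_of x)).
  by rewrite mulrAC ler_pdivlMr// mulrC.
have K2 : T n.+1 x <= 3 / (1 - p) * (Z + T n (right_of x)).
  by rewrite mulrAC ler_pdivlMr// mulrC.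
move: C1 K1 K2 (T0 0%N x) (T0 n (up_of x)) (T0 n (right_of x)).
move: (3 / (1 - p)) (T 0%N x) (T n (up_of x)) (T n (right_of x)) => k t u v k1 K1 K2 t0 u0 v0.
apply: le_trans K2 _; rewrite expr2 -mulrA ler_pM2l; last by apply: lt_le_trans k1.
have : v <= k * v by rewrite ler_peMl.
by move: K1; lra.
Qed.

Lemma unblocked_le n : exists2 K : R, 0 <= K &
  forall f s M eta, uniq s -> depends_on s f -> {subset s <= M} ->
  {in s, forall x, (right_of x \in M) && (up_of x \in M)} ->
  \sum_(x <- s) avg M (fun e => (unblocked n x e)%:R * site_var x f e) eta <=
  K * \sum_(x <- s) avg M (fun e => (constraint x e)%:R * site_var x f e) eta.
Proof.
elim: n => [|n [K K0 IH]].
  by exists 1 => // f s M eta us fs sM nM; rewrite mul1r.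
(* Shifts are injective, so the terms at the right and upper neighbours each sum to at most the sum
   at order [n]: hence the [2 * K]. *)
exists ((3 / (1 - p)) ^+ 2 * (1 + 2 * K)).
  by rewrite mulr_ge0 ?sqr_ge0// addr_ge0// mulr_ge0.
move=> f s M eta us fs sM nM.
pose T m y := avg M (fun e => (unblocked m y e)%:R * site_var y f e) eta.
have T0 m y : 0 <= T m y.
  by apply: avg_ge0 => // e; rewrite mulr_ge0 ?ler0n ?site_var_ge0.
have Ts m y : y \notin s -> T m y = 0.
  move=> ys; rewrite /T -[RHS](avg_cst p M 0 eta); apply: eq_avg => e.
  rewrite site_var_free ?mulr0//; apply: depends_on_free fs _ => x xs.
  by rewrite inE; apply: contraNneq ys => <-.
apply: (@le_trans _ _ (\sum_(x <- s) (3 / (1 - p)) ^+ 2 *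
    (T 0%N x + T n (right_of x) + T n (up_of x)))).
  rewrite big_seq [leRHS]big_seq; apply: ler_sum => x xs.
  by have /andP[? ?] := nM x xs; apply: unblocked_step => //; exact: sM.
have I := IH f s M eta us fs sM nM.
have Ir := sum_shift_le us right_of_inj (T0 n) (Ts n).
have Iu := sum_shift_le us up_of_inj (T0 n) (Ts n).
rewrite -mulr_sumr -[leRHS]mulrA ler_wpM2l ?sqr_ge0// !big_split/=.
have {}Ir := le_trans Ir I; have {}Iu := le_trans Iu I.
rewrite [_ * _](_ : _ = \sum_(x <- s) T 0%N x + K * \sum_(x <- s) T 0%N x +
  K * \sum_(x <- s) T 0%N x); last by rewrite /T; ring.
by rewrite !lerD.
Qed.

End unblocked_moves.

Lemma eq_path_step (S : pred site) k (T : pred site) (e e' : Omega) (x : site) :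
  (forall y : site, S y -> y.1 + y.2 < x.1 + x.2 + k%:Z -> e y = e' y) ->
  iter k (path_step S e) T x = iter k (path_step S e') T x.
Proof.
elim: k x => //= k IH x H; rewrite /path_step.
case Sx : (S x) => //=; rewrite -(H x) //; last by lia.
by congr (_ && (_ || _)); apply: IH => y Sy /= ?; apply: H => //; lia.
Qed.

Lemma path_step_mono (S : pred site) k (T T' : pred site) (e e' : Omega) x :
  (forall y, e y -> e' y) -> (forall y, T y -> T' y) ->
  iter k (path_step S e) T x -> iter k (path_step S e') T' x.
Proof.
move=> ee TT; elim: k x => [|k IH] x /=; first exact: TT.
rewrite /path_step; by move=> /and3P[-> /ee -> /orP[/IH ->|/IH ->]]; rewrite ?orbT.
Qed.

Lemma conn_mono n (e e' : Omega) x :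
  (forall y, e y -> e' y) -> conn n e x -> conn n e' x.
Proof. by move=> ee; exact: path_step_mono. Qed.

Lemma conn_leq m n e x : (m <= n)%N -> conn n e x -> conn m e x.
Proof.
elim: m n x => [|m IH] n x mn; first exact: conn_occupied.
case: n mn => // n mn; rewrite !connS => /andP[-> /orP[]/IH->//].
by rewrite orbT.
Qed.

Lemma conn_cat k m (S : pred site) e x z :
  iter k (path_step S e) (pred1 z) x -> conn m e z -> conn (k + m) e x.
Proof.
move=> + zm; elim: k x => [|k IH] x /=; first by move=> /eqP ->.
move=> /and3P[_ ex xz]; change (is_true (conn (k + m).+1 e x)); rewrite connS ex.
by case/orP: xz => /IH ->; rewrite ?orbT.
Qed.

Lemma path_step_level k (S : pred site) e (x z : site) :
  iter k (path_step S e) (pred1 z) x ->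
  [/\ x.1 <= z.1, x.2 <= z.2 & z.1 + z.2 = x.1 + x.2 + k%:Z].
Proof.
elim: k x => [|k IH] x /=; first by move=> /eqP ->; split => //; lia.
by move=> /and3P[_ _ /orP[]/IH[/= ? ? ?]]; split; lia.
Qed.

(* The path is cut where it first leaves [S]. *)
Lemma conn_first_exit n m (S : pred site) e (x : site) :
  (forall z : site, S z -> z.1 + z.2 < x.1 + x.2 + n%:Z) ->
  conn (n + m) e x ->
  exists z k, [/\ (k <= n)%N, ~~ S z, iter k (path_step S e) (pred1 z) x & conn m e z].
Proof.
elim: n x => [|n IH] x HS.
  move=> xm; exists x, 0%N; split=> //=.
  by apply/negP => /HS; rewrite addr0 ltxx.
have [Sx|Sx] := boolP (S x); last first.
  move=> xm; exists x, 0%N; split=> //=.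
  by apply: conn_leq xm; rewrite leq_addl.
rewrite addSn connS => /andP[ex /orP[]].
  move=> /IH [z Sz /=|z [k [kn Sz zk zm]]]; first by have := HS z Sz; lia.
  by exists z, k.+1; split=> //=; rewrite /path_step Sx ex zk.
move=> /IH [z Sz /=|z [k [kn Sz zk zm]]]; first by have := HS z Sz; lia.
by exists z, k.+1; split=> //=; rewrite /path_step Sx ex zk orbT.
Qed.

Definition triangle n : seq site :=
  [seq (i%:Z, j%:Z) | i <- iota 0 n.+1, j <- iota 0 (n.+1 - i)].

Lemma mem_triangle n (x : site) :
  (x \in triangle n) = [&& 0 <= x.1, 0 <= x.2 & x.1 + x.2 <= n%:Z].
Proof.
apply/allpairsPdep/and3P => [[i [j [+ + ->]]]|].
  by rewrite !mem_iota /= => ? ?; split; lia.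
case: x => -[a|a] -[b|b] [] // _ _ abn; rewrite /= in abn; exists a, b.
by split=> //; rewrite mem_iota; lia.
Qed.

Lemma triangle_uniq n : uniq (triangle n).
Proof.
apply: allpairs_uniq_dep; first exact: iota_uniq.
  by move=> i _; exact: iota_uniq.
by move=> [i j] [i' j'] _ _ /= [-> ->].
Qed.

Lemma size_triangle n : (size (triangle n) <= n.+1 ^ 2)%N.
Proof.
rewrite size_allpairs_dep sumnE big_map -[in iota 0 n.+1](subn0 n.+1) -/(index_iota 0 n.+1).
rewrite (@leq_trans (\sum_(0 <= i < n.+1) n.+1))//; last by rewrite sum_nat_const_nat subn0 mulnn.
by apply: leq_sum => i _; rewrite size_iota leq_subr.
Qed.

Definition shift (v : site) (e : Omega) : Omega := fun x => e (x + v).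

Lemma conn_shift n v e x : conn n (shift v e) x = conn n e (x + v).
Proof.
elim: n x => [//|n IH] x; rewrite !connS !IH /shift.
by congr (_ && (conn n e _ || conn n e _)); congr pair => /=; lia.
Qed.

Lemma update_shift v (e : Omega) x b : update (shift v e) x b = shift v (update e (x + v) b).
Proof. by apply/funext => y; rewrite /update /shift (inj_eq (addIr v)). Qed.

Lemma avg_shift {R : realType} (p : R) s v (f : Omega -> R) e :
  avg p s f (shift v e) = avg p [seq x + v | x <- s] (fun e => f (shift v e)) e.
Proof.
elim: s e => //= x s IH e; rewrite !site_meanE -!IH.
by rewrite !update_shift.
Qed.

Lemma avg_depends {R : realType} (p : R) (f : Omega -> R) s t e e' :
  depends_on s f -> {subset s <= t} -> avg p t f e = avg p s f e'.
Proof.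
move=> fs st.
have fr : free_of [seq x <- t | x \notin s] f.
  by apply: depends_on_free fs _ => x xs; rewrite mem_filter xs.
have -> : avg p t f = avg p s f.
  rewrite (avg_filterC p (mem s)) (@avg_free _ p [seq x <- t | ~~ _]) //.
  apply: eq_avg_mem => x; rewrite mem_filter /=.
  by apply: andb_idr => /st.
pose w : Omega := fun x => if x \in s then e x else e' x.
transitivity (avg p s f w); last first.
  by apply: (@avg_is_free _ p s f) => x xs; rewrite /w (negbTE xs).
have ew : {in s, e =1 w} by move=> x xs; rewrite /w xs.
suff gen t' u u' : {in s, u =1 u'} -> avg p t' f u = avg p t' f u' by exact: gen.
elim: t' u u' => [|x t' IH] u u' uu' /=; first exact: fs.
rewrite !site_meanE; congr (_ * _ + _ * _); apply: IH => // y ys;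
  by rewrite /update; case: eqP => // _; exact: uu'.
Qed.

(** * Exponential decay of connections *)

Definition level (z : site) : nat := absz (z.1 + z.2).

Lemma lt_level (y z : site) : 0 <= z.1 -> 0 <= z.2 ->
  y.1 + y.2 < 0 + 0 + (level z)%:Z -> y.1 + y.2 < z.1 + z.2.
Proof. by rewrite /level; lia. Qed.

(** The probability of an [n]-step occupied path from the origin. The configuration [fun=> false] is
    a dummy: [triangle n] contains every site that is read. *)
Definition theta {R : realType} (p : R) (n : nat) : R :=
  avg p (triangle n) (fun e => (conn n e 0)%:R) (fun=> false).

Lemma eq_conn_on n (x : site) (M : seq site) (e e' : Omega) :
  (forall v, v \in triangle n -> v + x \in M) -> {in M, e =1 e'} ->
  conn n e x = conn n e' x.
Proof.
move=> H ee; apply: eq_conn => y h1 h2 h3; apply: ee.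
rewrite -(subrK x y); apply: H; rewrite mem_triangle; apply/and3P.
by case: y x h1 h2 h3 => [y1 y2] [x1 x2] /= h1 h2 h3; split; lia.
Qed.

Lemma depends_on_conn {R : realType} n (x : site) (M : seq site) :
  (forall v, v \in triangle n -> v + x \in M) ->
  depends_on M (fun e => (conn n e x)%:R : R).
Proof. by move=> H e e' ee; rewrite (eq_conn_on H ee). Qed.

Lemma avg_conn {R : realType} (p : R) n (x : site) M e :
  (forall v, v \in triangle n -> v + x \in M) ->
  avg p M (fun e => (conn n e x)%:R) e = theta p n.
Proof.
move=> H; pose e0 : Omega := fun=> false.
rewrite (@avg_depends _ _ _ [seq v + x | v <- triangle n] M _ e0); last 2 first.
- by apply: depends_on_conn => v vn; exact: (map_f (fun v => v + x)).
- by move=> _ /mapP[v vn ->]; exact: H.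
rewrite /theta -[fun=> false]/(shift x e0) avg_shift; apply: eq_avg => u.
by rewrite conn_shift add0r.
Qed.

(* Its average is the site version of the quantity [phi_p(S)] of Duminil-Copin
   and Tassion. *)
Definition exits {R : realType} (S : seq site) (n : nat) (e : Omega) : R :=
  \sum_(z <- triangle n | z \notin S)
    (iter (level z) (path_step [in S] e) (pred1 z) 0)%:R.

Lemma ler_sum_term {R : realType} (I : eqType) (r : seq I) (P : pred I) (F : I -> R) i :
  i \in r -> P i -> (forall j, P j -> 0 <= F j) -> F i <= \sum_(j <- r | P j) F j.
Proof.
move=> + Pi F0; elim: r => // j r IH; rewrite inE big_cons => /predU1P[<-|/IH ir].
  by rewrite Pi lerDl; exact: sumr_ge0.
by case: ifP => // /F0 j0; rewrite (le_trans ir)// lerDr.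
Qed.

Section sharpness.
Context {R : realType}.
Implicit Types (p s : R) (S M L : seq site) (e eta : Omega).

Lemma theta_ge0 p n : 0 <= p <= 1 -> 0 <= theta p n.
Proof. by move=> p01; apply: avg_ge0 => // e; rewrite ler0n. Qed.

Lemma depends_on_exits S n : depends_on S (exits S n : Omega -> R).
Proof.
move=> e e' ee; apply: eq_bigr => z _; congr (nat_of_bool _)%:R.
by apply: eq_path_step => y yS _; exact: ee.
Qed.

(** A path of [n + m] steps leaves [S] at some [z] with at least [m] steps to go. The piece before
    [z] reads levels below that of [z], the piece after it sites at or above that level, so the
    probabilities multiply. *)
Lemma theta_exits p S n m eta : 0 <= p <= 1 ->
  (forall z, z \in S -> z.1 + z.2 < n%:Z) ->
  theta p (n + m) <= avg p S (exits S n) eta * theta p m.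
Proof.
move=> p01 Sn.
pose M := S ++ triangle (n + m).
rewrite -(@avg_conn _ p (n + m) 0 M eta); last first.
  by move=> v vn; rewrite addr0 mem_cat vn orbT.
rewrite -(@avg_depends _ p (exits S n) S M eta eta (@depends_on_exits _ _)); last first.
  by move=> x xS; rewrite mem_cat xS.
rewrite avg_sum mulr_suml.
apply: (@le_trans _ _ (avg p M (fun e => \sum_(z <- triangle n | z \notin S)
   (iter (level z) (path_step [in S] e) (pred1 z) 0)%:R * (conn m e z)%:R) eta)).
  apply: le_avg => // e.
  have [c0|//] := boolP (conn (n + m) e 0); last first.
    by rewrite /= sumr_ge0// => z _; rewrite mulr_ge0 ?ler0n.
  have [|z [k [kn zS zk zm]]] := @conn_first_exit n m [in S] e 0 _ c0.
    by move=> z /= /Sn; rewrite !add0r.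
  have [/= h1 h2 h3] := path_step_level zk.
  have kE : level z = k by rewrite /level; lia.
  apply: le_trans (@ler_sum_term _ _ _ _ _ z _ zS _).
  - by rewrite kE zk zm mulr1.
  - by rewrite mem_triangle; apply/and3P; split; lia.
  - by move=> y _; rewrite mulr_ge0 ?ler0n.
rewrite avg_sum; rewrite big_seq_cond [leRHS]big_seq_cond.
apply: ler_sum => z /andP[]; rewrite mem_triangle => /and3P[z1 z2 zn] zS.
rewrite (@avg_indep _ p M _ _ eta (fun x => z.1 + z.2 <= x.1 + x.2)); last 2 first.
- move=> e e' ee; congr (nat_of_bool _)%:R; apply: eq_path_step => y _ /= yz.
  by apply: ee; rewrite mem_filter negb_and -ltNge (lt_level z1 z2 yz).
- move=> e e' ee; congr (nat_of_bool _)%:R; apply: eq_conn => y h1 h2 _.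
  by apply: ee; rewrite mem_filter negb_and negbK lerD.
rewrite avg_conn//.
move=> v; rewrite mem_triangle mem_cat mem_triangle => /and3P[v1 v2 vm].
by apply/orP; right; apply/and3P; split; rewrite /=; lia.

Qed.

End sharpness.

(** * Russo's formula, monotonicity in the density, partial revealing *)

Section russo.
Context {R : realType}.
Implicit Types (p s : R) (S M L : seq site) (e eta : Omega) (f : Omega -> R).

(** Russo's formula for an arbitrary [f], by the product rule one site at a time. *)
Lemma is_derive_avg L f eta p : uniq L ->
  is_derive p 1 (fun s => avg s L f eta) (\sum_(x <- L) avg p L (grad x f) eta).
Proof.
elim: L eta => [|x L IH] eta.
  by move=> _; rewrite big_nil /=; exact: is_derive_cst.
rewrite cons_uniq => /andP[xL uL].
have -> : (fun s => avg s (x :: L) f eta) = (fun s =>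
    s * avg s L f (update eta x true) + (1 - s) * avg s L f (update eta x false)).
  by apply/funext => s; rewrite avg_cons site_meanE.
have It := IH (update eta x true) uL.
have If := IH (update eta x false) uL.
apply: is_derive_eq.
rewrite big_cons avg_cons site_mean_free; last by apply: free_avg; exact: free_grad.
rewrite -grad_avg// /grad.
under eq_bigr => y _ do rewrite avg_cons site_meanE.
rewrite big_split/= -!mulr_sumr /GRing.scale/=.
ring.
Qed.

Definition increasing f :=
  forall e e' : Omega, (forall y, e y -> e' y) -> f e <= f e'.

Lemma increasing_avg p L f : 0 <= p <= 1 -> increasing f -> increasing (avg p L f).
Proof.
move=> p01 fI; elim: L => //= x L IH e e' ee; rewrite !site_meanE.
have /andP[? ?] := p01.
apply: lerD; apply: ler_wpM2l; rewrite ?subr_ge0//; apply: IH => y;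
  by rewrite /update; case: eqP => // _; exact: ee.
Qed.

(** The induction on sites stands in for the monotone coupling of the two densities. *)
Lemma avg_le_param p s L f eta : 0 <= p -> p <= s -> s <= 1 -> increasing f ->
  avg p L f eta <= avg s L f eta.
Proof.
move=> p0 ps s1 fI; elim: L eta => //= x L IH eta; rewrite !site_meanE.
have := IH (update eta x true); have := IH (update eta x false).
have : avg s L f (update eta x false) <= avg s L f (update eta x true).
  apply: increasing_avg => //; first by rewrite s1 (le_trans p0 ps).
  by move=> y; rewrite /update; case: eqP.
move: (avg p L f _) (avg p L f _) (avg s L f _) (avg s L f _) => a b c d dc bd ac.
have p1 : 0 <= 1 - p by rewrite subr_ge0 (le_trans ps s1).
have h1 : p * a <= p * c by rewrite ler_wpM2l.
have h2 : (1 - p) * b <= (1 - p) * d by rewrite ler_wpM2l.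
have h3 : 0 <= (s - p) * (c - d) by rewrite mulr_ge0// subr_ge0.
move: h1 h2 h3; lra.
Qed.

(** Whether [y] is resampled is decided by variables that come after [y]. Hence, for the first site
    [x], no decision reads [x], and averaging over [x] gives the same result whether or not [x] was
    already averaged. *)
Lemma avg_stopping p (Q : site -> Omega -> bool) L M f eta :
  pairwise before L -> {subset L <= M} ->
  (forall x y, x \in L -> y \in L -> ~~ before y x -> free_of [:: x] (Q y)) ->
  avg p M (fun e => avg p [seq y <- L | ~~ Q y e] f e) eta = avg p M f eta.
Proof.
elim: L => [//|x L IH]; rewrite pairwise_cons => /andP[/allP xL pL] LM QF.
have LM' : {subset L <= M} by move=> y yL; apply: LM; rewrite inE yL orbT.
have xM : x \in M by apply: LM; rewrite inE eqxx.
have QF' y z : y \in L -> z \in L -> ~~ before z y -> free_of [:: y] (Q z).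
  by move=> yL zL; apply: QF; rewrite inE ?yL ?zL orbT.
rewrite -(IH pL LM' QF').
pose G e := avg p [seq y <- L | ~~ Q y e] f e.
have Qx y : y \in x :: L -> free_of [:: x] (Q y).
  move=> yL; apply: QF => //; first by rewrite inE eqxx.
  by move: yL; rewrite inE => /predU1P[->|/xL /before_asym ->//]; rewrite before_irr.
have xM' : {subset [:: x] <= M} by move=> y; rewrite inE => /eqP ->.
rewrite -(avg_absorbr p (fun e => avg p [seq y <- x :: L | ~~ Q y e] f e) xM').
rewrite -/G -[in RHS](avg_absorbr p G xM'); apply: eq_avg => e /=.
have FE e' b : [seq y <- L | ~~ Q y (update e' x b)] = [seq y <- L | ~~ Q y e'].
  apply: eq_in_filter => y yL.
  by rewrite (free_of_update _ _ (Qx y _)) ?inE ?yL ?orbT.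
have GE e' : G e' = avg p [seq y <- L | ~~ Q y e'] f e' by [].
rewrite !site_meanE !(free_of_update _ _ (Qx x _)) ?inE ?eqxx// !FE !GE !FE.
case: (Q x e) => //=.
by rewrite !site_meanE !update_update; ring.
Qed.

End russo.

(** What [conn m e z] becomes once [z] is made occupied. *)
Definition reopened m (z : site) e :=
  if m is m'.+1 then conn m' e (right_of z) || conn m' e (up_of z) else true.

Lemma conn_reopened m e z : conn m e z = e z && reopened m z e.
Proof. by case: m => [|m]; rewrite ?andbT// connS. Qed.

Lemma eq_reopened m (z : site) (e e' : Omega) :
  (forall y : site, z.1 <= y.1 -> z.2 <= y.2 -> y <> z -> e y = e' y) ->
  reopened m z e = reopened m z e'.
Proof.
case: m => //= m H; congr orb; apply: eq_conn => y /= h1 h2 _; apply: H; try lia;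
  move=> yz; move: h1 h2; rewrite yz; lia.
Qed.

(** The cube of Bernoulli's inequality gives [(k * h) ^+ 3 * r ^+ k <= 1]; the extra power of [k]
    makes the square version small. *)
Lemma sqr_geometric_small {R : realType} (r eps : R) : 0 <= r -> r < 1 -> 0 < eps ->
  exists N : nat, forall k, (N <= k)%N -> k%:R ^+ 2 * r ^+ k <= eps.
Proof.
(* For [h <= 1] one has [(1 + h) ^+ 3 <= 1 + 7 * h], and this [h] turns the right side into [2 - r],
   where [(2 - r) * r <= 1]. *)
move=> r0 r1 e0; pose h := (1 - r) / 7.
have h0 : 0 < h by rewrite /h; lra.
have h1 : h <= 1 by rewrite /h; lra.
have hr : (1 + h) ^+ 3 * r <= 1.
  have : (1 + h) ^+ 3 <= 1 + 7 * h by nra.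
  move=> /(ler_wpM2r r0)/le_trans; apply.
  have -> : (1 + 7 * h) * r = 1 - (1 - r) ^+ 2 by rewrite /h; field.
  by rewrite gerBl sqr_ge0.
have h3 : 0 < h ^+ 3 * eps by rewrite mulr_gt0// exprn_gt0.
have [N HN] : exists N : nat, (h ^+ 3 * eps)^-1 < N%:R.
  by exists (Num.bound (h ^+ 3 * eps)^-1); apply: archi_boundP; rewrite invr_ge0 ltW.
exists N => k Nk.
have kN : (h ^+ 3 * eps)^-1 <= k%:R by rewrite (le_trans (ltW HN))// ler_nat.
have k0 : 0 < k%:R :> R by apply: lt_le_trans kN; rewrite invr_gt0.
have bern : k%:R * h <= (1 + h) ^+ k.
  elim: (k) => [|j IH]; first by rewrite mul0r expr0.
  rewrite exprS mulrDl mul1r; apply: (@le_trans _ _ (j%:R * h + h)).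
    by rewrite -[in leLHS]addn1 natrD mulrDl mul1r.
  apply: lerD => //; rewrite -[leLHS]mulr1 ler_wpM2l ?(ltW h0)// exprn_ege1//; lra.
have : (k%:R * h) ^+ 3 * r ^+ k <= 1.
  apply: (@le_trans _ _ (((1 + h) ^+ k) ^+ 3 * r ^+ k)).
    rewrite ler_wpM2r ?exprn_ge0// lerXn2r// nnegrE ?exprn_ge0//; last by lra.
    by rewrite mulr_ge0 ?ler0n// ltW.
  rewrite exprAC -exprMn exprn_ile1// mulr_ge0// exprn_ge0//.
  by rewrite addr_ge0// ltW.
have -> : (k%:R * h) ^+ 3 * r ^+ k = (k%:R * h ^+ 3) * (k%:R ^+ 2 * r ^+ k) by ring.
move=> H; rewrite -(ler_pM2l (_ : 0 < k%:R * h ^+ 3)); last first.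
  by rewrite mulr_gt0// exprn_gt0.
apply: le_trans H _; rewrite -mulrA.
by rewrite -ler_pdivrMr// div1r.
Qed.

Lemma subn_level_eq0 n (z : site) : n%:Z <= z.1 + z.2 -> (n - level z)%N = 0%N.
Proof. by rewrite /level; lia. Qed.

(** By descending levels: a site that is not reopened starts no path to level [n] whatever its own
    variable, so only variables at reopened sites are ever consulted. *)
Lemma eq_reopened_on n (e e' : Omega) :
  (forall y, y \in triangle n -> reopened (n - level y) y e -> e y = e' y) ->
  forall z, z \in triangle n -> reopened (n - level z) z e = reopened (n - level z) z e'.
Proof.
move=> H z; have [m mE] : exists m, (n - level z)%N = m by eexists.
rewrite mE; elim: m z mE => // m IH z mE.
rewrite mem_triangle => /and3P[z1 z2 zn].
suff K y : y \in triangle n -> (n - level y)%N = m -> conn m e y = conn m e' y.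
  by rewrite /= !K ?mem_triangle//=; rewrite /level/= in mE *; do ?[apply/and3P; split]; lia.
move=> yn ym; rewrite !conn_reopened -(IH y)//.
have := H y yn; rewrite ym; case: (reopened m y e); rewrite ?andbF// => ->//.
Qed.

(** * The differential inequality and the decay of [theta] *)

Section sharpness.
Context {R : realType}.
Implicit Types (p s : R) (S : seq site) (n : nat).

Lemma increasing_conn n : increasing (fun e => (conn n e 0)%:R : R).
Proof.
move=> e e' ee; rewrite ler_nat.
by case: (boolP (conn n e 0)) => // /(conn_mono ee) ->.
Qed.

(** Under this event [z] must be empty, and filling it would join a path from the origin to a path
    reaching level [n]: a closed pivotal site. *)
Definition pivotal_closed n (z : site) e :=
  [&& reopened (n - level z) z e, iter (level z) (path_step predT e) (pred1 z) 0
    & ~~ conn n e 0].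

Lemma pivotal_closed_grad n z e : z \in triangle n ->
  (pivotal_closed n z e)%:R <= grad z (fun e => (conn n e 0)%:R : R) e.
Proof.
rewrite mem_triangle => /and3P[z1 z2 zn].
have [/and3P[Hr Ht Hc]|_] := boolP (pivotal_closed n z e); last first.
  rewrite subr_ge0; apply: increasing_conn => y.
  by rewrite /update; case: eqP.
have -> : grad z (fun e => (conn n e 0)%:R : R) e = 1; last by [].
rewrite /grad.
have -> : conn n (update e z true) 0.
  have -> : n = (level z + (n - level z))%N by rewrite /level; lia.
  apply: (@conn_cat _ _ predT _ _ z).
    rewrite -(@eq_path_step _ _ _ e)// => y _ /(lt_level z1 z2) yz.
    by rewrite update_neq//; apply: contraTneq yz => ->; rewrite ltxx.
  rewrite conn_reopened update_eq -(@eq_reopened _ _ e)// => y _ _ /eqP yz.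
  by rewrite update_neq.
have -> : conn n (update e z false) 0 = false.
  apply: contraNF Hc; apply: conn_mono => y.
  by rewrite /update; case: eqP.
by rewrite subr0.
Qed.

(* Revealing the sites from the top of the triangle, only below sites that are
   still connected to level [n], leaves the set [S] of sites that are cut off
   from level [n] independent of what was revealed. *)
Lemma theta_derivative_ge p n eta : 0 <= p <= 1 ->
  (forall S eta, (forall z, z \in S -> z.1 + z.2 < n%:Z) ->
    1 <= avg p S (exits S n) eta) ->
  1 - theta p n <=
  \sum_(z <- triangle n) avg p (triangle n) (grad z (fun e => (conn n e 0)%:R)) eta.
Proof.
move=> p01 phi1.
pose g e : R := \sum_(z <- triangle n) (pivotal_closed n z e)%:R.
apply: (@le_trans _ _ (avg p (triangle n) g eta)); last first.
  rewrite avg_sum big_seq [leRHS]big_seq; apply: ler_sum => z zn.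
  by apply: le_avg => // e; exact: pivotal_closed_grad.
have [L Ln pL] := lex_sorted (triangle n).
rewrite -(eq_avg_mem _ _ Ln).
(* Reveal the reopened sites only; [S] below collects the unrevealed ones, whose variables are then
   averaged afresh. *)
rewrite -(@avg_stopping _ _ (fun y => reopened (n - level y) y) L L)//; last first.
  move=> x y _ _ yx; apply: free_of1P => e b; apply: eq_reopened => u h1 h2 uy.
  rewrite update_neq//; apply: contraNneq yx => <-.
  move/eqP: uy; case: u y h1 h2 => [u1 u2] [y1 y2] /=.
  by rewrite /before/= xpair_eqE; lia.
rewrite -(@avg_conn _ p n 0 L eta); last first.
  by move=> v vn; rewrite addr0 Ln.
rewrite -[X in X - _](avg_cst p L 1 eta) -avgB; apply: le_avg => // e.
set S := [seq y <- L | _].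
have g0 e' : 0 <= g e' by apply: sumr_ge0 => z _; rewrite ler0n.
have stable e' : agree_off S e e' -> forall z, z \in triangle n ->
    reopened (n - level z) z e = reopened (n - level z) z e'.
  move=> ee; apply: eq_reopened_on => y yn yr; apply: ee.
  by rewrite mem_filter yr.
have O : (0 : site) \in triangle n by rewrite mem_triangle.
have lev0 : (n - level (0 : site)%R)%N = n by rewrite /level/= subn0.
(* If the origin is reopened and occupied, the left side is 0. If it is reopened and empty, it is
   itself a closed pivotal site. *)
have [r0|r0] := boolP (reopened n 0 e).
  have [e0|e0] := boolP (e 0).
    by rewrite conn_reopened e0 r0 subrr avg_ge0.
  apply: (@le_trans _ _ 1); first by rewrite gerBl ler0n.
  rewrite -[leLHS](avg_cst p S 1 e); apply: le_avg_at => // e' ee.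
  apply: le_trans (@ler_sum_term _ _ _ xpredT _ 0 O isT (fun j _ => ler0n _ _)).
  rewrite /pivotal_closed -(stable e')// lev0 r0 /=.
  suff -> : conn n e' 0 = false by [].
  apply/negbTE; apply: contraNN e0 => /conn_occupied.
  by rewrite ee// mem_filter lev0 r0.
(* Here the origin is cut off for every filling of [S]. A site of the triangle outside [S] is
   reopened, so every exit from [S] counted by [exits] is a closed pivotal site, and the hypothesis
   on [S] applies. *)
apply: (@le_trans _ _ 1); first by rewrite gerBl ler0n.
apply: le_trans (phi1 S e _) _.
  move=> z; rewrite mem_filter Ln mem_triangle => /andP[zr /and3P[z1 z2 zn]].
  rewrite ltNge; apply: contraNN zr => nz.
  by rewrite subn_level_eq0.
apply: le_avg_at => // e' ee; rewrite /exits big_mkcond /=.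
rewrite /g big_seq [leRHS]big_seq; apply: ler_sum => z zn.
case: ifP => zS; last by rewrite ler0n.
have [Hz|_] := boolP (iter _ _ _ _); last by rewrite ler0n.
rewrite /pivotal_closed -(stable e')//.
have -> : reopened (n - level z) z e.
  by apply: contraTT zS => zr; rewrite negbK mem_filter zr Ln zn.
have -> : iter (level z) (path_step predT e') (pred1 z) 0.
  elim: (level z) (0 : site) Hz => //= k IH x /and3P[_ xe /orP[]/IH xz];
    by rewrite /path_step xe xz ?orbT.
suff -> : conn n e' 0 = false by [].
by have := stable e' ee 0 O; rewrite lev0 (negbTE r0) conn_reopened => <-; rewrite andbF.
Qed.

(** Mean value theorem on [[p, s]]: the bound on exits passes from [p] to the intermediate density
    by monotonicity, and there the derivative is at least [1 - theta s n]. *)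
Lemma theta_ge_of_exits p s n : 0 <= p -> p < s -> s <= 1 ->
  (forall S eta, (forall z, z \in S -> z.1 + z.2 < n%:Z) ->
    1 <= avg p S (exits S n) eta) ->
  (s - p) * (1 - theta s n) <= theta s n.
Proof.
move=> p0 ps s1 phi1.
have inc S : increasing (exits S n : Omega -> R).
  move=> e e' ee; apply: ler_sum => z _; rewrite ler_nat.
  case: (boolP (iter _ (path_step _ e) _ _)) => // H.
  by rewrite (path_step_mono ee _ H).
pose F (q : R) : R := theta q n.
have [||c] := @MVT R F (fun q => \sum_(z <- triangle n)
  avg q (triangle n) (grad z (fun e => (conn n e 0)%:R)) (fun=> false)) p s ps.
- by move=> x _; apply: is_derive_avg; exact: triangle_uniq.
- apply: derivable_within_continuous => x _.
  by have [] := @is_derive_avg R (triangle n) (fun e => (conn n e 0)%:R) (fun=> false) x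
    (triangle_uniq n).
rewrite in_itv/= => /andP[pc cs] FE.
have p01 : 0 <= p <= 1 by rewrite p0 (le_trans (ltW ps)).
have c01 : 0 <= c <= 1 by rewrite (le_trans p0 (ltW pc)) (le_trans (ltW cs)).
have D := @theta_derivative_ge c n (fun=> false) c01.
have {}D := D (fun S eta HS => le_trans (phi1 S eta HS)
  (avg_le_param _ _ p0 (ltW pc) (le_trans (ltW cs) s1) (@inc S))).
have cs' : theta c n <= theta s n.
  by case/andP: c01 => c0 _; apply: avg_le_param => //; [exact: ltW|exact: increasing_conn].
have thp := @theta_ge0 R p n p01.
apply: (@le_trans _ _ (F s - F p)); last by rewrite /F gerBl.
rewrite FE [leLHS]mulrC ler_wpM2r ?subr_ge0 ?(ltW ps)//.
by apply: le_trans D; rewrite lerD2l lerN2.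
Qed.

Lemma theta_subcritical p s : 0 <= p -> p < s -> s <= 1 ->
  (forall eps : R, 0 < eps -> exists n, theta s n <= eps) ->
  forall eps : R, 0 < eps -> exists n, n.+2%:R ^+ 2 * theta p n <= eps.
Proof.
move=> p0 ps s1 ths eps eps0.
have p01 : 0 <= p <= 1 by rewrite p0 (le_trans (ltW ps)).
have [n [S [eta [HS phi1]]]] : exists n S eta,
    (forall z, z \in S -> z.1 + z.2 < n%:Z) /\ avg p S (exits S n) eta < 1.
  apply: contrapT => H.
  (* As [s - p <= 1], this forces [(s - p) * (1 - theta s n)] to be at least three quarters of
     [s - p], which exceeds [theta s n]. *)
  have [|n thn] := ths ((s - p) / 4); first by rewrite divr_gt0// subr_gt0.
  have : (s - p) * (1 - theta s n) <= theta s n.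
    apply: theta_ge_of_exits p0 ps s1 _ => S eta HS; rewrite leNgt.
    by apply/negP => phi1; apply: H; exists n, S, eta.
  have : 0 < s - p by rewrite subr_gt0.
  move: thn ps s1 p0; nra.
set phi := avg _ _ _ _ in phi1.
have phi0 : 0 <= phi by apply: avg_ge0 => // e; apply: sumr_ge0 => z _; rewrite ler0n.
have decay k : theta p (n * k) <= phi ^+ k.
  elim: k => [|k IH].
    rewrite muln0 expr0 -[leRHS](avg_cst p (triangle 0) 1 (fun=> false)).
    by apply: le_avg => // e; rewrite lern1 leq_b1.
  rewrite mulnS exprS; apply: le_trans (theta_exits _ eta p01 HS) _.
  by rewrite ler_wpM2l.
have [|N HN] := @sqr_geometric_small R phi (eps / n.+2%:R ^+ 2) phi0 phi1.
  by rewrite divr_gt0// exprn_gt0.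
(* [n * N.+1 + 2] is at most [n.+2 * N.+1], so the polynomial factor splits. *)
exists (n * N.+1)%N.
apply: (@le_trans _ _ (n.+2%:R ^+ 2 * (N.+1%:R ^+ 2 * phi ^+ N.+1))).
  rewrite mulrA ler_pM ?sqr_ge0 ?theta_ge0//.
  rewrite -!natrX -natrM ler_nat -expnMn leq_sqr; lia.
by rewrite mulrC -ler_pdivlMr ?exprn_gt0//; exact: HN.
Qed.

End sharpness.

(** * Poincare inequality uniform in the volume *)

Section finite_volume_gap.
Context {R : realType} (p : R) (p0 : 0 <= p) (p1 : p < 1).

Let p01 : 0 <= p <= 1. Proof. by rewrite p0 ltW. Qed.

Lemma finite_volume_poincare :
  (forall eps : R, 0 < eps -> exists n, n.+2%:R ^+ 2 * theta p n <= eps) ->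
  exists n, exists2 C : R, 0 < C & forall f s M eta, uniq s -> depends_on s f ->
  {subset s <= M} -> {in s, forall x v, v \in triangle n -> x + v \in M} ->
  avg_var p M f eta <=
    C * \sum_(x <- s) avg p M (fun e => (constraint x e)%:R * site_var p x f e) eta.
Proof.
(* With [delta = 2 * theta p n] and at most [n.+2 ^ 2] translates, 1/8 makes the absorbed
   coefficient at most 1/2. *)
move=> th; have [|n thn] := th (1 / 8); first by rewrite divr_gt0.
have [K K0 HK] := @unblocked_le R p p0 p1 n.
(* [unblocked n] looks [n.+1] steps ahead. Absorption gives half the variance below [2 * K] times
   the energy; the extra 1 keeps the constant positive. *)
exists n.+1; exists (4 * K + 1); first by rewrite ltr_wpDl// mulr_ge0.
move=> f s M eta us fs sM nM.
pose D := rem (0 : site) (triangle n.+1).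
have O : (0 : site) \in triangle n.+1 by rewrite mem_triangle.
have memD v : (v \in D) = (v != 0) && (v \in triangle n.+1).
  by rewrite (mem_rem_uniq _ (triangle_uniq _)).
have sD : (size D).+1 = size (triangle n.+1) by rewrite /D size_rem// prednK//; case: (triangle _) O.
have nbhdP x v (w : site) : w + x = v -> w.1 + w.2 <= n.+1%:Z -> 0 <= w.1 -> 0 <= w.2 ->
    w != 0 -> v \in [seq x + v | v <- D].
  move=> <- w3 w1 w2 w0; rewrite addrC; apply: (map_f (fun v => x + v)).
  by rewrite memD w0 mem_triangle w1 w2.
have right_nbhd (x v : site) : v \in triangle n -> v + right_of x \in [seq x + v | v <- D].
  rewrite mem_triangle => /and3P[v1 v2 vn]; apply: (@nbhdP x _ (v + (1, 0))).
  - by case: v x {v1 v2 vn} => [? ?] [? ?]; congr pair => /=; lia.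
  - by case: v v1 v2 vn => [? ?] /=; lia.
  - by case: v v1 v2 vn => [? ?] /=; lia.
  - by case: v v1 v2 vn => [? ?] /=; lia.
  - by case: v v1 v2 vn => [? ?] /=; rewrite xpair_eqE /=; lia.
have up_nbhd (x v : site) : v \in triangle n -> v + up_of x \in [seq x + v | v <- D].
  rewrite mem_triangle => /and3P[v1 v2 vn]; apply: (@nbhdP x _ (v + (0, 1))).
  - by case: v x {v1 v2 vn} => [? ?] [? ?]; congr pair => /=; lia.
  - by case: v v1 v2 vn => [? ?] /=; lia.
  - by case: v v1 v2 vn => [? ?] /=; lia.
  - by case: v v1 v2 vn => [? ?] /=; lia.
  - by case: v v1 v2 vn => [? ?] /=; rewrite xpair_eqE /=; lia.
have th0 := @theta_ge0 R p n p01.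
have : (1 - 2 * (2 * theta p n) * (size D).+1%:R) * avg_var p M f eta <=
    2 * \sum_(x <- s) avg p M (fun e => (unblocked n x e)%:R * site_var p x f e) eta.
  apply: constrained_poincare => //.
  - exact: rem_uniq (triangle_uniq _).
  - move=> [v1 v2]; rewrite memD mem_triangle /before /= xpair_eqE /=; lia.
  - move=> x e e' ee; rewrite /unblocked; congr (~~ _ && ~~ _).
      exact: eq_conn_on (right_nbhd x) ee.
    exact: eq_conn_on (up_nbhd x) ee.
  - move=> x e; rewrite mulr_natl mulr2n -[X in X + _](avg_conn p e (right_nbhd x)).
    rewrite -[X in _ + X](avg_conn p e (up_nbhd x)) -avgD.
    apply: le_avg => // u; rewrite /unblocked.
    by case: (conn _ u _); case: (conn _ u _) => /=; lra.
  - by move=> x xs _ /mapP[v + ->]; rewrite memD => /andP[_ vn]; exact: nM.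
have HT := HK f s M eta us fs sM.
have {HT} HT : \sum_(x <- s) avg p M (fun e => (unblocked n x e)%:R * site_var p x f e) eta <=
    K * \sum_(x <- s) avg p M (fun e => (constraint x e)%:R * site_var p x f e) eta.
  apply: HT => x xs; rewrite -[right_of x]/(x.1 + 1, x.2) -[up_of x]/(x.1, x.2 + 1).
  have -> : (x.1 + 1, x.2) = x + (1, 0) :> site by congr pair; rewrite /= addr0.
  have -> : (x.1, x.2 + 1) = x + (0, 1) :> site by congr pair; rewrite /= addr0.
  by rewrite !nM// mem_triangle /=; lia.
have V0 : 0 <= avg_var p M f eta by exact: avg_var_ge0.
have E0 : 0 <= \sum_(x <- s) avg p M (fun e => (constraint x e)%:R * site_var p x f e) eta.
  by apply: sumr_ge0 => x _; apply: avg_ge0 => // e; rewrite mulr_ge0 ?ler0n ?site_var_ge0.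
have small : 2 * (2 * theta p n) * (size D).+1%:R <= 1 / 2.
  have : (size D).+1%:R * theta p n <= n.+2%:R ^+ 2 * theta p n.
    by rewrite ler_wpM2r// -natrX ler_nat sD size_triangle.
  by move: thn; lra.
move: HT V0 E0 small.
move: (avg_var _ _ _ _) (\sum_(x <- s) _) (\sum_(x <- s) _) => V T E.
move: (2 * (2 * theta p n) * _) => a HT V0 E0 a2 H.
have : a * V <= 1 / 2 * V by rewrite ler_wpM2r.
move: H HT; lra.
Qed.

End finite_volume_gap.

(** * Local functions and integrals *)

Local Open Scope classical_set_scope.
Local Open Scope ring_scope.

Lemma measurable_occupied (x : site) : measurable_fun setT (fun e : Omega => e x).
Proof.
apply: (@measurable_fun_bool _ _ _ _ true); rewrite setTI.
apply: sub_sigma_algebra; exists x => //.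
Qed.

(** Branching on one variable shortens the support, which drives the inductions on local
    functions. *)
Lemma depends_on_split {R : realType} x s (f : Omega -> R) :
  depends_on (x :: s) f ->
  (forall b, depends_on s (fun e => f (update e x b))) /\
  f = (fun e => if e x then f (update e x true) else f (update e x false)).
Proof.
move=> fs; split.
  move=> b e e' ee; apply: fs => y; rewrite inE /update.
  by case: eqP => //= _ /ee.
apply/funext => e; case: ifP => ex; congr f; apply/funext => y;
  by rewrite /update; case: eqP => // ->.
Qed.

Lemma measurable_local {R : realType} s (f : Omega -> R) :
  depends_on s f -> measurable_fun setT f.
Proof.
elim: s f => [|x s IH] f fs.
  rewrite (_ : f = cst (f (fun=> false))); first exact: measurable_cst.
  by apply/funext => e; exact: fs.
have [fb ->] := depends_on_split fs.
by apply: measurable_fun_ifT; [exact: measurable_occupied|exact: IH|exact: IH].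
Qed.

Lemma bounded_local {R : realType} s (f : Omega -> R) :
  depends_on s f -> exists B : R, forall e, `|f e| <= B.
Proof.
elim: s f => [|x s IH] f fs.
  by exists `|f (fun=> false)| => e; rewrite (fs e (fun=> false)).
have [fb fE] := depends_on_split fs.
have [B1 H1] := IH _ (fb true); have [B0 H0] := IH _ (fb false).
exists (Num.max B1 B0) => e; rewrite fE le_max.
by case: (e x); rewrite ?H1 ?H0 ?orbT.
Qed.

Section product_measure_integral.
Context {R : realType} (p : R) (p01 : 0 <= p <= 1).
Local Notation mu := (product_measure p).

Lemma integrable_bounded (f : Omega -> R) (B : R) : measurable_fun setT f ->
  (forall e, `|f e| <= B) -> mu.-integrable setT (EFin \o f).
Proof.
move=> mf fB; apply: measurable_bounded_integrable => //.
  exact: le_lt_trans (probability_le1 mu measurableT) (ltry _).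
exists B; split; first exact: num_real.
by move=> M BM e _ /=; rewrite (le_trans (fB e))// ltW.
Qed.

Lemma integrable_local s (f : Omega -> R) :
  depends_on s f -> mu.-integrable setT (EFin \o f).
Proof.
move=> fs; have [B fB] := bounded_local fs.
exact: integrable_bounded (measurable_local fs) fB.
Qed.

Definition cylinder (t : seq site) (eta : Omega) : set Omega :=
  [set e : Omega | forall x, x \in t -> e x = eta x].

Lemma measurable_cylinder t eta : measurable (cylinder t eta).
Proof.
elim: t => [|x t IH].
  by rewrite (_ : cylinder _ _ = setT)//; apply/seteqP; split.
rewrite (_ : cylinder _ _ = [set e : Omega | e x = eta x] `&` cylinder t eta).
  apply: measurableI => //.
  by have := measurable_occupied x measurableT (_ : measurable [set eta x]); rewrite setTI; exact.
apply/seteqP; split => e /=.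
  by move=> H; split=> [|y yt]; apply: H; rewrite inE ?eqxx ?yt ?orbT.
by move=> [H1 H2] y; rewrite inE => /predU1P[->//|]; exact: H2.
Qed.

(** Each site still to be averaged splits the cylinder in two and joins [t], the list of frozen
    sites; once [s] is exhausted, [f] is constant on the cylinder. The case [t = [::]] is
    [integral_local]. *)
Lemma integral_cylinder s t (f : Omega -> R) eta : uniq (s ++ t) ->
  depends_on (s ++ t) f ->
  \int[mu]_(e in cylinder t eta) f e =
  \prod_(x <- t) bernoulli_pmf p (eta x) * avg p s f eta.
Proof.
elim: s t eta => [|x s IH] t eta.
  rewrite cat0s => ut ft /=.
  rewrite (@eq_Rintegral _ _ _ _ _ (cst (f eta))); last first.
    by move=> e; rewrite inE => H; exact: ft.
  rewrite Rintegral_cst; last exact: measurable_cylinder.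
  by rewrite [X in fine X](product_measure_cylinder p01 eta ut) mulrC.
move=> u f_s.
have mem_eq : x :: s ++ t =i s ++ x :: t.
  by move=> y; rewrite !(inE, mem_cat) orbCA.
have u' : uniq (s ++ x :: t).
  rewrite uniq_catC /= uniq_catC; move: u; rewrite /= !mem_cat orbC.
  by case/andP => -> ->.
have xt : x \notin t.
  by move: u; rewrite /= mem_cat negb_or => /andP[/andP[]].
have f_s' : depends_on (s ++ x :: t) f.
  by move=> e e' ee; apply: f_s => y; rewrite mem_eq; exact: ee.
pose c b := cylinder (x :: t) (update eta x b).
have cE : cylinder t eta = c true `|` c false.
  apply/seteqP; split => e /=.
    move=> H; case ex : (e x); [left|right] => y; rewrite inE => /orP[/eqP ->|yt];
      rewrite ?update_eq// update_neq ?H//; by apply: contraNneq xt => <-.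
  move=> [] H y yt; rewrite H ?inE ?yt ?orbT// update_neq//;
    by apply: contraNneq xt => <-.
have cd : [disjoint c true & c false].
  apply/disj_set2P; apply/seteqP; split => // e [/= H1 H2].
  have := H1 x; have := H2 x; rewrite inE eqxx !update_eq => /(_ isT) -> /(_ isT).
  by [].
rewrite cE Rintegral_setU//; [|exact: measurable_cylinder|exact: measurable_cylinder|]; last first.
  by rewrite -cE; apply: integrableS (integrable_local f_s) => //; exact: measurable_cylinder.
rewrite !IH// !big_cons !update_eq avg_cons site_meanE.
have pE b : \prod_(y <- t) bernoulli_pmf p (update eta x b y) =
    \prod_(y <- t) bernoulli_pmf p (eta y).
  by apply: eq_big_seq => y yt; rewrite update_neq//; apply: contraNneq xt => <-.
by rewrite !pE /bernoulli_pmf; ring.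
Qed.

Lemma integral_local s (f : Omega -> R) eta : depends_on s f ->
  \int[mu]_e f e = avg p s f eta.
Proof.
move=> fs.
have fs' : depends_on (undup s ++ [::]) f.
  by rewrite cats0 => e e' ee; apply: fs => x xs; apply: ee; rewrite mem_undup.
have := @integral_cylinder (undup s) [::] f eta _ fs'.
rewrite cats0 undup_uniq big_nil mul1r (eq_avg_mem _ _ (mem_undup s)) => <- //.
by congr (\int[_]_(_ in _) _); apply/seteqP; split.
Qed.

End product_measure_integral.

(** * Inner product and convergence in L^2 *)

Section square_integrable.
Context d (T : measurableType d) (R : realType) (mu : probability T R).
Implicit Types (f g h : T -> R).
Local Notation L2 := (Lfun mu 2%:E).

Definition inner f g : R := \int[mu]_x (f x * g x).

Lemma L2_add f g : f \in L2 -> g \in L2 -> (fun x => f x + g x) \in L2.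
Proof. by move=> Lf Lg; exact: (Lfun_addr_closed mu (lee1n 2)).2 Lf Lg. Qed.

Lemma L2_opp f : f \in L2 -> (fun x => - f x) \in L2.
Proof. by move=> Lf; exact: (Lfun_oppr_closed Lf). Qed.

Lemma L2_sub f g : f \in L2 -> g \in L2 -> f \- g \in L2.
Proof. by move=> Lf Lg; exact: L2_add Lf (L2_opp Lg). Qed.

Lemma L2_scale (a : R) f : f \in L2 -> (fun x => a * f x) \in L2.
Proof.
move=> Lf; rewrite (_ : (fun x => _) = a \o* f); last by apply/funext => x /=; rewrite mulrC.
by apply: Lfun_scale => //; rewrite ler1n.
Qed.

Lemma L2_cst (a : R) : (fun=> a) \in L2.
Proof. exact: Lfun_cst. Qed.

Lemma L2_mul_integrable f g : f \in L2 -> g \in L2 ->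
  mu.-integrable setT (EFin \o (fun x => f x * g x)).
Proof. by move=> Lf Lg; apply/Lfun1_integrable; exact: Lfun2_mul_Lfun1. Qed.

Lemma L2_integrable f : f \in L2 -> mu.-integrable setT (EFin \o f).
Proof.
move=> Lf; have := L2_mul_integrable Lf (L2_cst 1).
by rewrite (_ : (fun x => f x * 1) = f)//; apply/funext => x; rewrite mulr1.
Qed.

Lemma innerC f g : inner f g = inner g f.
Proof. by apply: eq_Rintegral => x _; rewrite mulrC. Qed.

Lemma innerDl f g h : f \in L2 -> g \in L2 -> h \in L2 ->
  inner (fun x => f x + g x) h = inner f h + inner g h.
Proof.
move=> Lf Lg Lh; rewrite /inner -RintegralD//; try exact: L2_mul_integrable.
by apply: eq_Rintegral => x _; rewrite mulrDl.
Qed.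

Lemma innerZl (a : R) f h : f \in L2 -> h \in L2 ->
  inner (fun x => a * f x) h = a * inner f h.
Proof.
move=> Lf Lh; rewrite /inner -RintegralZl//; try exact: L2_mul_integrable.
by apply: eq_Rintegral => x _; rewrite mulrA.
Qed.

Lemma inner_ge0 f : 0 <= inner f f.
Proof. by apply: Rintegral_ge0 => x _; rewrite -expr2 sqr_ge0. Qed.

Lemma inner_cauchy_schwarz f g : f \in L2 -> g \in L2 ->
  `|inner f g| <= Num.sqrt (inner f f) * Num.sqrt (inner g g).
Proof.
move=> Lf Lg; rewrite -sqrtrM ?inner_ge0// -sqrtr_sqr; apply: ler_wsqrtr.
set A := inner f f; set B := inner f g; set C := inner g g.
have H (t : R) : 0 <= A - 2 * t * B + t ^+ 2 * C.
  have Lt := L2_scale (- t) Lg; have Ls := L2_add Lf Lt.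
  have := inner_ge0 (fun x => f x + - t * g x).
  rewrite innerDl// innerZl// ![inner _ (fun x => f x + _)]innerC !innerDl//.
  rewrite !innerZl// (innerC g f) -/A -/B -/C.
  by congr (0 <= _); ring.
have A0 : 0 <= A by exact: inner_ge0.
have C0 : 0 <= C by exact: inner_ge0.
have [CE|Cn0] := eqVneq C 0.
  have [->|Bn0] := eqVneq B 0; first by rewrite CE expr0n/= mulr0.
  have := H ((A + 1) / (2 * B)); rewrite CE mulr0 addr0.
  have -> : 2 * ((A + 1) / (2 * B)) * B = A + 1 by field.
  lra.
have := H (B / C).
have -> : A - 2 * (B / C) * B + (B / C) ^+ 2 * C = (A * C - B ^+ 2) / C by field.
by rewrite pmulr_lge0 ?invr_gt0 ?lt_def ?Cn0// subr_ge0.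
Qed.

Lemma Lnorm2E f : f \in L2 -> 'N[mu]_2%:E[EFin \o f]%E = (Num.sqrt (inner f f))%:E.
Proof.
move=> Lf; rewrite unlock /Lnorm.
have -> : (\int[mu]_x `|(EFin \o f) x| `^ 2)%E = (inner f f)%:E.
  rewrite /inner /Rintegral fineK; last first.
    exact: integrable_fin_num (L2_mul_integrable Lf Lf).
  apply: eq_integral => x _ /=.
  by rewrite powR_mulrn// -normrX ger0_norm ?sqr_ge0// expr2.
by rewrite poweR_EFin powR12_sqrt// inner_ge0.
Qed.

Lemma cvg_Lnorm2 (u : nat -> T -> R) :
  (forall n, u n \in L2) ->
  ('N[mu]_2%:E[EFin \o u n]%E @[n --> \oo] --> 0%E) <->
  (Num.sqrt (inner (u n) (u n)) @[n --> \oo] --> (0 : R)).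
Proof.
move=> Lu.
rewrite (_ : (fun n => _) = (fun n => (Num.sqrt (inner (u n) (u n)))%:E)); last first.
  by apply/funext => n; rewrite Lnorm2E.
split; first by move/fine_cvg.
by move=> H; apply/fine_cvgP; split => //; exact: nearW.
Qed.

Lemma cvg_inner (u v : nat -> T -> R) f g : f \in L2 -> g \in L2 ->
  (forall n, u n \in L2) -> (forall n, v n \in L2) ->
  ('N[mu]_2%:E[EFin \o (u n \- f)%R]%E @[n --> \oo] --> 0%E) ->
  ('N[mu]_2%:E[EFin \o (v n \- g)%R]%E @[n --> \oo] --> 0%E) ->
  inner (u n) (v n) @[n --> \oo] --> inner f g.
Proof.
move=> Lf Lg Lu Lv.
have Luf n : u n \- f \in L2 by exact: L2_sub.
have Lvg n : v n \- g \in L2 by exact: L2_sub.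
move=> /(cvg_Lnorm2 Luf) Hu /(cvg_Lnorm2 Lvg) Hv.
have E n : inner (u n) (v n) - inner f g =
    inner (u n \- f) (v n \- g) + inner (u n \- f) g + inner f (v n \- g).
  have -> : inner (u n) (v n) = inner (fun x => (u n \- f) x + f x) (fun x => (v n \- g) x + g x).
    by apply: eq_Rintegral => x _ /=; rewrite !subrK.
  have Lw := L2_add (Lvg n) Lg.
  rewrite (innerDl (Luf n) Lf Lw) ![inner _ (fun x => (v n \- g) x + _)]innerC.
  rewrite (innerDl (Lvg n) Lg (Luf n)) (innerDl (Lvg n) Lg Lf).
  rewrite (innerC (v n \- g) (u n \- f)) (innerC g (u n \- f)) (innerC (v n \- g) f) (innerC g f).
  by ring.
rewrite -[X in _ --> X]add0r -(_ : (fun n => (inner (u n) (v n) - inner f g) + inner f g) =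
  (fun n => inner (u n) (v n))); last by apply/funext => n; rewrite subrK.
apply: cvgD; last exact: cvg_cst.
apply/norm_cvg0P.
set a := fun n => Num.sqrt (inner (u n \- f) (u n \- f)) in Hu.
set b := fun n => Num.sqrt (inner (v n \- g) (v n \- g)) in Hv.
apply: (squeeze_cvgr (f := cst 0) (h :=
  fun n => a n * b n + a n * Num.sqrt (inner g g) + Num.sqrt (inner f f) * b n)).
- apply: nearW => n /=; rewrite normr_ge0 /= E.
  rewrite (le_trans (ler_normD _ _))// lerD ?inner_cauchy_schwarz//.
  by rewrite (le_trans (ler_normD _ _))// lerD ?inner_cauchy_schwarz.
- exact: cvg_cst.
- rewrite -[X in _ --> X](_ : 0 * 0 + 0 * Num.sqrt (inner g g) + Num.sqrt (inner f f) * 0 = 0).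
    by apply: cvgD; [apply: cvgD; apply: cvgM => //; exact: cvg_cst|apply: cvgM => //; exact: cvg_cst].
  by rewrite !mul0r mulr0 !addr0.
Qed.

End square_integrable.

Lemma L2_bounded d (T : measurableType d) (R : realType) (mu : probability T R)
    (f : T -> R) (B : R) : measurable_fun setT f -> (forall x, `|f x| <= B) ->
  f \in Lfun mu 2%:E.
Proof.
move=> mf fB; rewrite inE; apply/andP; split; rewrite inE//=.
rewrite /finite_norm unlock /Lnorm poweR_lty//.
have -> : (\int[mu]_x `|(EFin \o f) x| `^ 2)%E = (\int[mu]_x ((f x ^+ 2)%R)%:E)%E.
  apply: eq_integral => x _ /=.
  by rewrite powR_mulrn// -normrX ger0_norm ?sqr_ge0.
apply: integrable_lty => //; apply: measurable_bounded_integrable => //.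
- exact: le_lt_trans (probability_le1 mu measurableT) (ltry _).
- exact: measurable_funX.
- exists (B ^+ 2); split; first exact: num_real.
  move=> M BM x _ /=; apply: le_trans (ltW BM).
  by rewrite normrX lerXn2r// ?nnegrE// (le_trans _ (fB x)).
Qed.

(** * Dirichlet form, variance and passage to the closure *)

Section local_functions.
Context {R : realType} (p : R) (p01 : 0 <= p <= 1).
Local Notation mu := (product_measure p).

Lemma L2_local s (f : Omega -> R) : depends_on s f -> f \in Lfun mu 2%:E.
Proof.
move=> fs; have [B fB] := bounded_local fs.
exact: L2_bounded (measurable_local fs) fB.
Qed.

Lemma inner_local s (f g : Omega -> R) eta : depends_on s f -> depends_on s g ->
  inner mu f g = avg p s (fun e => f e * g e) eta.
Proof.
move=> fs gs; apply: integral_local => //.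
by move=> e e' ee; rewrite (fs _ _ ee) (gs _ _ ee).
Qed.

Lemma depends_on_sub s t (f : Omega -> R) : {subset s <= t} ->
  depends_on s f -> depends_on t f.
Proof. by move=> st fs e e' ee; apply: fs => x /st /ee. Qed.

Lemma depends_on_local_generator s t (f : Omega -> R) : uniq s -> depends_on s f ->
  {subset s <= t} -> {in s, forall x, (right_of x \in t) && (up_of x \in t)} ->
  depends_on t (local_generator p f).
Proof.
move=> us fs st nt e e' ee; rewrite !(local_generatorE p _ us fs).
have fst := depends_on_sub st fs.
apply: eq_big_seq => x xs; have /andP[rx ux] := nt x xs.
rewrite /constraint -[(_, _)]/(right_of x) -[(x.1, _)]/(up_of x) !ee//.
congr (_ * (_ - _)); last exact: fst.
rewrite !site_meanE; congr (_ * _ + _ * _); apply: fst => y yt;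
  by rewrite /update; case: eqP => // _; exact: ee.
Qed.

Lemma L2_local_generator (f : Omega -> R) : local_function f ->
  local_generator p f \in Lfun mu 2%:E.
Proof.
case=> s0 fs0.
have fs : depends_on (undup s0) f by apply: depends_on_sub fs0 => x; rewrite mem_undup.
pose s := undup s0.
apply: (@L2_local (s ++ map right_of s ++ map up_of s)).
apply: depends_on_local_generator (undup_uniq s0) fs _ _.
  by move=> x xs; rewrite mem_cat xs.
by move=> x xs; rewrite !mem_cat !map_f ?orbT.
Qed.

(** The constraint at [x] does not read [x], so averaging over [x] first turns [f] times
    [f - site_mean p x f] into the variance at [x]. *)
Lemma dirichlet_local s M (f : Omega -> R) eta : uniq s -> depends_on s f ->
  {subset s <= M} -> {in s, forall x, (right_of x \in M) && (up_of x \in M)} ->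
  dirichlet_form p f (local_generator p f) =
  \sum_(x <- s) avg p M (fun e => (constraint x e)%:R * site_var p x f e) eta.
Proof.
move=> us fs sM nM.
rewrite -[LHS]/(inner mu f (fun e => - local_generator p f e)).
rewrite (@inner_local M _ _ eta); first last.
- by move=> e e' ee; rewrite (depends_on_local_generator us fs sM nM ee).
- exact: depends_on_sub fs.
rewrite -avg_sum; transitivity (avg p M (fun e => \sum_(x <- s)
    (constraint x e)%:R * (f e * f e - f e * site_mean p x f e)) eta).
  apply: eq_avg => e; rewrite (local_generatorE p _ us fs) mulrN mulr_sumr -sumrN.
  by apply: eq_bigr => x _; ring.
rewrite !avg_sum; apply: eq_big_seq => x xs.
have xM : {subset [:: x] <= M} by move=> y; rewrite inE => /eqP ->; exact: sM.
rewrite -[in LHS](avg_absorbr p _ xM) -[in RHS](avg_absorbr p _ xM); apply: eq_avg => e /=.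
have cE b : constraint x (update e x b) = constraint x e.
  by rewrite /constraint !update_neq// eq_sym; apply: site_neq => /=; lia.
rewrite !site_meanE /site_var /grad !update_update !cE.
ring.
Qed.

Lemma var_local s (f : Omega -> R) eta : depends_on s f -> var p f = avg_var p s f eta.
Proof.
move=> fs; rewrite /var /avg_var (@integral_local R p p01 s f eta)//.
rewrite (@integral_local R p p01 s (fun e => f e ^+ 2) eta)//.
by move=> e e' ee; rewrite (fs _ _ ee).
Qed.

Lemma varE (f : Omega -> R) : var p f = inner mu f f - inner mu f (fun=> 1) ^+ 2.
Proof.
rewrite /var /inner; congr (_ - _ ^+ 2); apply: eq_Rintegral => e _.
by rewrite mulr1.
Qed.

Lemma var_centered (f : Omega -> R) : f \in Lfun mu 2%:E ->
  var p f = inner mu (fun e => f e - inner mu f (fun=> 1)) (fun e => f e - inner mu f (fun=> 1)).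
Proof.
move=> Lf; set m := inner mu f _.
have L1 := @L2_cst _ _ _ mu (- m).
have Lg := L2_add Lf L1.
rewrite innerDl// ![inner _ _ (fun x => f x + _)]innerC !innerDl//.
have -> : inner mu (fun=> - m) (fun=> - m) = m ^+ 2.
  rewrite /inner Rintegral_cst// (_ : fine _ = 1) ?mulr1 ?mulrNN ?expr2//.
  by rewrite [X in fine X](probability_setT mu).
have mE : inner mu f (fun=> - m) = - m * m.
  rewrite innerC /inner RintegralZl//; last exact: L2_integrable.
  by congr (_ * _); apply: eq_Rintegral => e _; rewrite mulr1.
by rewrite [inner mu (fun=> - m) f]innerC mE varE -/m; ring.
Qed.

(** This allows the denominator in [spectral_gap] to be cleared. *)
Lemma var_gt0 (f : Omega -> R) : f \in Lfun mu 2%:E -> ~ ae_constant p f -> 0 < var p f.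
Proof.
move=> Lf cf; rewrite lt_neqAle var_centered// inner_ge0 andbT eq_sym.
apply/eqP => v0; apply: cf; exists (inner mu f (fun=> 1)).
have Lg := L2_add Lf (@L2_cst _ _ _ mu (- inner mu f (fun=> 1))).
have N0 := Lnorm2E Lg; rewrite v0 sqrtr0 in N0.
have mg : measurable_fun setT (EFin \o (fun e => f e - inner mu f (fun=> 1))).
  by move: Lg; rewrite inE => /andP[/[!inE]/= mg _]; exact/measurable_EFinP.
have := Lnorm_eq0_eq0 mg _ N0; rewrite lte_fin ltr0n => /(_ isT).
apply: filterS => e /= /(_ I) [] /eqP; rewrite subr_eq0 => /eqP.
by [].
Qed.

(** A pair in the graph is an L^2 limit of local functions and their images; variance and Dirichlet
    form are continuous in both, so the inequality survives the limit and the gap is at least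
    [C^-1]. *)
Theorem spectral_gap_gt0 (C : R) : 0 < C ->
  (forall f, local_function f -> var p f <= C * dirichlet_form p f (local_generator p f)) ->
  (0 < spectral_gap p)%E.
Proof.
move=> C0 H; apply: (@lt_le_trans _ _ (C^-1)%:E); first by rewrite lte_fin invr_gt0.
apply: le_ereal_inf_tmp => _ [[f g] /= [[Lf Lg [u [ul uf ug]]] cf] <-].
have Lu n : u n \in Lfun mu 2%:E by have [s us] := ul n; exact: L2_local us.
have LLu n : local_generator p (u n) \in Lfun mu 2%:E by exact: L2_local_generator.
rewrite lee_fin ler_pdivlMr ?var_gt0// mulrC ler_pdivrMr// mulrC.
have c1 := cvg_inner Lf Lf Lu Lu uf uf.
have c2 : inner mu (u n) (fun=> 1) @[n --> \oo] --> inner mu f (fun=> 1).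
  apply: (@cvg_inner _ _ _ mu u (fun _ _ => 1)) => //; first exact: L2_cst.
    by move=> _; exact: L2_cst.
  rewrite (_ : EFin \o _ = cst 0%E) ?Lnorm0//; first exact: cvg_cst.
  by apply/funext => e /=; rewrite subrr.
have c3 := cvg_inner Lf Lg Lu LLu uf ug.
have -> : dirichlet_form p f g = - inner mu f g.
  rewrite -mulN1r -innerZl//; apply: eq_Rintegral => e _.
  by ring.
apply: (@ler_cvg_to nat \oo _ _
   (fun n => inner mu (u n) (u n) - inner mu (u n) (fun=> 1) ^+ 2)
   (fun n => C * - inner mu (u n) (local_generator p (u n)))).
- by rewrite varE; apply: cvgB => //; exact: cvgM.
- by apply: cvgM; [exact: cvg_cst|exact: cvgN].
- apply: nearW => n; rewrite -varE.
  have -> : - inner mu (u n) (local_generator p (u n)) =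
      dirichlet_form p (u n) (local_generator p (u n)).
    rewrite -mulN1r -innerZl//; apply: eq_Rintegral => e _.
    by ring.
  exact: H.
Qed.

End local_functions.

(** * Absence of percolation *)

Lemma path_step_last k (S : pred site) (T : pred site) (e : Omega) x :
  iter k (path_step S e) T x -> exists2 z, iter k (path_step S e) (pred1 z) x & T z.
Proof.
elim: k x => [|k IH] x /=; first by move=> Tx; exists x => //=.
move=> /and3P[Sx ex /orP[]/IH[z H Tz]]; exists z => //;
  by rewrite /path_step Sx ex H ?orbT.
Qed.

(* The sites of the frontier themselves may be empty, so that the frontier does
   not depend on the variables of level [n]. *)
Definition frontier n (e : Omega) : seq site :=
  [seq z <- triangle n | (level z == n) && iter n (path_step predT e) (pred1 z) 0].

Lemma mem_frontier n e (z : site) :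
  (z \in frontier n e) = iter n (path_step predT e) (pred1 z) 0.
Proof.
rewrite mem_filter; apply/idP/idP => [/andP[/andP[_ ->]]//|H].
have [/= h1 h2 h3] := path_step_level H.
by rewrite H mem_triangle andbT /level; lia.
Qed.

Lemma frontier_uniq n e : uniq (frontier n e).
Proof. exact/filter_uniq/triangle_uniq. Qed.

Lemma conn_frontier n (e : Omega) : conn n e 0 = has e (frontier n e).
Proof.
apply/idP/hasP => [/path_step_last[z H ez]|[z + ez]].
  by exists z => //; rewrite mem_frontier.
by rewrite mem_frontier => H; rewrite -[n]addn0; apply: conn_cat H _.
Qed.

(** The occupied end of an [n]-step path has two successors, which belong to the next frontier
    whether occupied or not. *)
Lemma conn_frontier_pred n (e : Omega) : conn n e 0 = (frontier n.+1 e != [::]).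
Proof.
have E : conn n e 0 = iter n.+1 (path_step predT e) predT 0.
  rewrite iterSr; apply/idP/idP; apply: path_step_mono => // y; rewrite /path_step /=.
    by rewrite andbT.
  by case/andP.
rewrite E; apply/idP/idP => [/path_step_last[z H _]|].
  by apply/negP => /eqP f0; have := mem_frontier n.+1 e z; rewrite H f0.
case f0 : (frontier _ _) => [//|z s] _.
have : z \in frontier n.+1 e by rewrite f0 inE eqxx.
by rewrite mem_frontier; apply: path_step_mono.
Qed.

Lemma eq_frontier n (e e' : Omega) :
  (forall y : site, y.1 + y.2 < n%:Z -> e y = e' y) -> frontier n e = frontier n e'.
Proof.
move=> H; apply: eq_filter => z; congr andb; apply: eq_path_step => y _.
by rewrite !add0r => yn; exact: H.
Qed.

(** Both successors of [x] are empty, so no path continues past [x], and by the level condition none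
    of the paths considered ends at [x]. *)
Lemma conn_update_constraint m (x y : site) (e : Omega) b :
  constraint x e -> x.1 + x.2 < y.1 + y.2 + m%:Z ->
  conn m (update e x b) y = conn m e y.
Proof.
move=> /andP[rx ux]; elim: m y => [|m IH] y xy.
  by rewrite /conn/= update_neq//; apply: contraTneq xy => ->; rewrite addr0 ltxx.
rewrite !connS; have [->|yx] := eqVneq y x.
  have occ c z : ~~ e z -> z != x -> conn m (update e x c) z = false.
    by move=> ez zx; apply/negP => /conn_occupied; rewrite update_neq// (negbTE ez).
  have occ' z : ~~ e z -> conn m e z = false.
    by move=> ez; apply: contraNF ez => /conn_occupied.
  rewrite !occ ?occ'// ?andbF//; rewrite eq_sym; apply: site_neq => /=; lia.
rewrite update_neq//; congr (_ && (_ || _)); apply: IH => /=; lia.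
Qed.

Section frontier_average.
Context {R : realType} (p : R) (p_gt0 : 0 < p) (p_lt1 : p < 1).

Let p01 : 0 <= p <= 1. Proof. by rewrite !ltW. Qed.

Lemma avg_all_empty (s t : seq site) eta : uniq s -> {subset s <= t} ->
  avg p t (fun e => (all (fun y => ~~ e y) s)%:R) eta = (1 - p) ^+ size s.
Proof.
move=> us st; rewrite -(avg_absorbr p _ st) -[RHS](avg_cst p t _ eta).
apply: eq_avg => e {st eta}; elim: s us e => [|y s IH] //= /andP[ys us] e.
rewrite site_meanE.
have E b : avg p s (fun e => (~~ e y && all (fun y => ~~ e y) s)%:R) (update e y b) =
    (~~ b)%:R * (1 - p) ^+ size s.
  rewrite -(IH us (update e y b)) -avgZ; apply: eq_avg_at => e' ee.
  by rewrite -ee// update_eq; case: b ee => /= _; rewrite ?mul0r ?mul1r.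
by rewrite !E exprS /=; ring.
Qed.

Definition almost_empty (s : seq site) (x : site) (e : Omega) :=
  all (fun y => ~~ e y) (rem x s).

(** A legal flip can change the event only at a frontier site, and only if all other frontier sites
    are empty; such a flip contributes at most 1. *)
Lemma local_generator_conn_le n (e : Omega) :
  `|local_generator p (fun e => (conn n e 0)%:R) e| <=
  \sum_(x <- frontier n e) (almost_empty (frontier n e) x e)%:R.
Proof.
have dep : depends_on (triangle n) (fun e => (conn n e 0)%:R : R).
  by apply: depends_on_conn => v; rewrite addr0.
rewrite (local_generatorE p e (triangle_uniq n) dep).
apply: le_trans (ler_norm_sum _ _ _) _.
have F b x : x \in triangle n -> level x = n -> frontier n (update e x b) = frontier n e.
  move=> xn lx; apply: eq_frontier => y yn; rewrite update_neq//.
  apply: contraTneq yn => ->; move: lx xn; rewrite mem_triangle => + /and3P[].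
  by rewrite /level; lia.
rewrite /frontier big_filter -/(frontier n e) [leRHS]big_mkcond/=.
rewrite big_seq [leRHS]big_seq; apply: ler_sum => x xn.
have [cx|_] := boolP (constraint x e); last first.
  by rewrite mul0r normr0; case: ifP => // _; rewrite ler0n.
rewrite mul1r.
have conn_eq b : ~~ (level x == n) -> conn n (update e x b) 0 = conn n e 0.
  move=> xl; apply: conn_update_constraint => //; rewrite !add0r.
  by move: xl xn; rewrite mem_triangle /level => + /and3P[]; lia.
have mean_eq c : (forall b, conn n (update e x b) 0 = c) -> conn n e 0 = c ->
    `|site_mean p x (fun e => (conn n e 0)%:R) e - (conn n e 0)%:R| = 0.
  move=> H ->; rewrite site_meanE !H; apply/normr0P; rewrite -mulrDl subrKC mul1r.
  by rewrite subrr.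
have [xl|xl] := boolP (level x == n); last first.
  by rewrite /= (mean_eq (conn n e 0))// => b; exact: conn_eq.
have [xf|xf] := boolP (iter _ _ _ _) => /=; last first.
  rewrite (mean_eq (conn n e 0))// => b.
  rewrite !conn_frontier F//; last exact/eqP.
  apply: eq_in_has => y; rewrite mem_frontier => yf; rewrite update_neq//.
  by apply: contraNneq xf => <-.
have xF : x \in frontier n e by rewrite mem_frontier.
have [|] := boolP (almost_empty _ _ _) => H; last first.
  move: H; rewrite -has_predC => /hasP[y yr /= /negPn ey].
  have [yx yF] : y != x /\ y \in frontier n e.
    by move: yr; rewrite (mem_rem_uniq _ (frontier_uniq _ _)) => /andP[].
  rewrite (mean_eq true)//.
    move=> b; rewrite conn_frontier F//; last exact/eqP.
    by apply/hasP; exists y => //; rewrite update_neq.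
  by rewrite conn_frontier; apply/hasP; exists y.
rewrite ler_norml site_meanE.
by case: (conn n e 0); case: (conn n _ 0); case: (conn n _ 0) => /=;
  apply/andP; split; move: p_gt0 p_lt1; lra.
Qed.

End frontier_average.

Section no_percolation.
Context {R : realType} (p : R) (p_gt0 : 0 < p) (p_lt1 : p < 1).
Local Notation mu := (product_measure p).

Let p01 : 0 <= p <= 1. Proof. by rewrite !ltW. Qed.

(** Large [s] are absorbed by [eps]; the finitely many remaining nonzero [s] by a multiple of
    [q ^+ s]. *)
Lemma sqr_geometric_interpolation (q eps : R) : 0 < q -> q < 1 -> 0 < eps ->
  exists2 C : R, 0 <= C & forall s : nat,
    s%:R ^+ 2 * q ^+ s.-1 <= eps + C * ((s != 0%N)%:R * q ^+ s).
Proof.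
move=> q0 q1 e0.
have [N HN] := sqr_geometric_small (ltW q0) q1 (mulr_gt0 e0 q0).
exists (N%:R ^+ 2 / q); first by rewrite divr_ge0 ?sqr_ge0// ltW.
case=> [|s]; first by rewrite /= ?mulr0n expr0n /= ?mulr0n !mul0r mulr0 addr0 ltW.
have q_s : q ^+ s.+1.-1 = q ^+ s.+1 / q by rewrite exprSr mulfK// gt_eqF.
rewrite q_s /= mul1r; have [/HN H|sN] := leqP N s.+1.
  rewrite mulrA (le_trans (_ : _ <= eps))//; first by rewrite ler_pdivrMr.
  by rewrite lerDl !mulr_ge0 ?sqr_ge0 ?invr_ge0 ?exprn_ge0 ?(ltW q0).
apply: (@le_trans _ _ (N%:R ^+ 2 / q * q ^+ s.+1)); last by rewrite lerDr ltW.
rewrite -mulrA [q^-1 * _]mulrC ler_wpM2r ?mulr_ge0 ?invr_ge0 ?exprn_ge0 ?(ltW q0)//.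
by rewrite -!natrX ler_nat leq_sqr ltnW.
Qed.

Let u n (e : Omega) : R := (conn n e 0)%:R.

Let u_local n : depends_on (triangle n) (u n).
Proof. by apply: depends_on_conn => v; rewrite addr0. Qed.

(** Let [S] be the frontier at level [n.+1] and [q = 1 - p]. Given the lower levels, the squared
    generator averages to at most [#|S|^2 * q^(#|S| - 1)], while the connection is lost at this
    level with probability [q^#|S|] if [S] is nonempty. The interpolation lemma compares the two. *)
Lemma inner_local_generator_conn (eps : R) : 0 < eps -> exists2 C : R, 0 <= C &
  forall n, inner mu (local_generator p (u n.+1)) (local_generator p (u n.+1)) <=
    eps + C * (theta p n - theta p n.+1).
Proof.
move=> e0; have q0 : 0 < 1 - p by rewrite subr_gt0.
have q1 : 1 - p < 1 by rewrite gtrBl.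
have [C C0 HC] := sqr_geometric_interpolation q0 q1 e0.
exists C => // n; pose N := n.+1; pose M := triangle N.+1; pose o : Omega := fun=> false.
have NM : {subset triangle N <= M}.
  by move=> [a b]; rewrite !mem_triangle /=; lia.
have nM : {subset triangle n <= M}.
  by move=> [a b]; rewrite !mem_triangle /=; lia.
rewrite (@inner_local _ p p01 M _ _ o); try (apply: depends_on_local_generator;
  [exact: triangle_uniq|exact: u_local|exact: NM|
   by move=> [a b]; rewrite !mem_triangle /=; lia]).
pose G e : R := (size (frontier N e))%:R *
  \sum_(x <- frontier N e) (almost_empty (frontier N e) x e)%:R.
pose H e := eps + C * (u n e - u N e).
have -> : eps + C * (theta p n - theta p N) = avg p M H o.
  rewrite avgD avg_cst avgZ avgB !avg_conn// => v; rewrite addr0; [exact: NM|exact: nM].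
apply: (@le_trans _ _ (avg p M G o)).
  apply: le_avg => // e; rewrite -expr2 -real_normK ?num_real//.
  have Le := local_generator_conn_le p_gt0 p_lt1 N e.
  set A := \sum_(_ <- _) _ in Le.
  have A0 : 0 <= A by apply: sumr_ge0 => x _; rewrite ler0n.
  apply: (@le_trans _ _ (A ^+ 2)); first by rewrite lerXn2r// nnegrE.
  rewrite expr2 ler_wpM2r// -sum1_size natr_sum; apply: ler_sum => x _.
  by case: almost_empty.
(* Averaging over [B] alone is conditioning on the lower levels, which determine the frontier. *)
pose B := [seq z <- triangle N | level z == N].
apply: (@le_avg_absorb _ p p01 B) => [z|e].
  by rewrite mem_filter => /andP[_ /NM].
set S := frontier N e.
have SE e' : agree_off B e e' -> frontier N e' = S.
  move=> ee; apply: eq_frontier => y yN; apply/esym/ee.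
  rewrite mem_filter negb_and mem_triangle; apply/orP.
  by case: y yN => a b /= yN; rewrite /level /=; lia.
have SB : {subset S <= B}.
  move=> z; rewrite /S /frontier !mem_filter => /andP[/andP[-> _] ->] //.
have uS := frontier_uniq N e.
have -> : avg p B G e = (size S)%:R ^+ 2 * (1 - p) ^+ (size S).-1.
  rewrite (@eq_avg_at _ _ _ _ (fun e' => (size S)%:R *
    \sum_(x <- S) (almost_empty S x e')%:R)); last by move=> e' ee; rewrite /G SE.
  rewrite avgZ avg_sum (eq_big_seq (fun=> (1 - p) ^+ (size S).-1)); last first.
    move=> x xS; rewrite avg_all_empty ?rem_uniq ?size_rem//.
    by move=> y /mem_rem /SB.
  by rewrite big_const_seq count_predT iter_addr_0 mulr_natl expr2 -mulrA !mulr_natl.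
apply: le_trans (HC (size S)) _.
rewrite avgD avg_cst avgZ lerD2l ler_wpM2l//.
rewrite size_eq0 -(avg_all_empty p e uS SB) -avgZ.
apply: le_avg_at => // e' ee.
rewrite /u conn_frontier_pred conn_frontier !SE// [all _ _](all_predC e').
case: (S) => [|z s] /=; first by rewrite mul0r subrr.
by rewrite mul1r; case: (_ || _); rewrite /= ?subrr ?subr0.
Qed.

End no_percolation.

(** * The percolation event and simplicity of the eigenvalue *)

Section simple_zero.
Context {R : realType} (p : R) (p_gt0 : 0 < p) (p_lt1 : p < 1).
Local Notation mu := (product_measure p).

Let p01 : 0 <= p <= 1. Proof. by rewrite !ltW. Qed.

Let u n (e : Omega) : R := (conn n e 0)%:R.

Let u_local n : depends_on (triangle n) (u n).
Proof. by apply: depends_on_conn => v; rewrite addr0. Qed.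

Let perc : set Omega := [set e | forall n, conn n e 0].

Let conn_set n : set Omega := [set e | conn n e 0].

Let measurable_conn_set n : measurable (conn_set n).
Proof.
have := measurable_local (@u_local n) measurableT (measurable_set1 1).
rewrite setTI; congr measurable.
by apply/seteqP; split => e; rewrite /conn_set /u /=; case: conn => //= /eqP;
  rewrite eq_sym oner_eq0.
Qed.

Let percE : perc = \bigcap_n conn_set n.
Proof. by apply/seteqP; split => e H n; [move=> _; exact: H|exact: H]. Qed.

Let measurable_perc : measurable perc.
Proof. by rewrite percE; exact: bigcap_measurable. Qed.

Let thetaE n : theta p n = fine (mu (conn_set n)).
Proof.
rewrite -(@avg_conn _ p n 0 (triangle n) (fun=> false)); last by move=> v; rewrite addr0.
rewrite -(integral_local p01 _ (@u_local n)) /Rintegral; congr fine.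
rewrite -[in RHS](setIT (conn_set n)) -integral_indic//.
apply: eq_integral => e _; rewrite /u indicE; congr ((nat_of_bool _)%:R%:E).
by apply/idP/idP; rewrite inE.
Qed.

Lemma theta_cvg : theta p n @[n --> \oo] --> fine (mu perc).
Proof.
have cv : (mu \o conn_set) n @[n --> \oo] --> mu perc.
  rewrite percE; apply: nonincreasing_cvg_mu => //.
  - exact: le_lt_trans (probability_le1 mu (measurable_conn_set 0)) (ltry _).
  - by rewrite -percE.
  - by move=> m n mn; apply/subsetPset => e; exact: conn_leq.
rewrite (_ : theta p = fine \o (mu \o conn_set)); last by apply/funext => n; rewrite thetaE.
by apply: fine_cvg; rewrite fineK// fin_num_measure.
Qed.

Let f (e : Omega) : R := \1_perc e.

Let measurable_f : measurable_fun setT f.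
Proof. exact: measurable_indic. Qed.

Let L2_f : f \in Lfun mu 2%:E.
Proof.
apply: (@L2_bounded _ _ _ mu f 1) => // e.
by rewrite /f indicE; case: (_ \in _); rewrite ?normr1 ?normr0.
Qed.

Let integral_f : \int[mu]_e f e = fine (mu perc).
Proof. by rewrite /Rintegral integral_indic// setIT. Qed.

Let L2_u n : u n \in Lfun mu 2%:E.
Proof. exact: (L2_local p (@u_local n)). Qed.

(** [u n] and [f] are indicators with [f <= u n], so their difference is its own square. *)
Let inner_u_sub n : inner mu (u n \- f) (u n \- f) = theta p n - fine (mu perc).
Proof.
rewrite -integral_f -(@avg_conn _ p n 0 (triangle n) (fun=> false)); last by move=> v; rewrite addr0.
rewrite -(integral_local p01 _ (@u_local n)) -RintegralB//; try exact: L2_integrable.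
apply: eq_Rintegral => e _; rewrite /u /f /= indicE.
have [|_] := boolP (e \in perc).
  by rewrite inE => /(_ n) ->; rewrite subrr mul0r.
by rewrite !subr0; case: conn; rewrite ?mul1r ?mul0r.
Qed.

Lemma generator_percolation : generator p f (fun e => 0 * f e).
Proof.
split=> //; first exact: L2_scale.
have Lg n : local_generator p (u n) \in Lfun mu 2%:E.
  by apply: L2_local_generator => //; exists (triangle n).
have L0 := L2_scale 0 L2_f.
(* Shifted by one, since the bound on the image of [u n.+1] involves the decrement from [theta p n]
   to [theta p n.+1], which vanishes in the limit. *)
exists (fun n => u n.+1); split.
- by move=> n; exists (triangle n.+1).
- apply/(cvg_Lnorm2 (fun n => L2_sub (L2_u n.+1) L2_f)).
  rewrite -[X in _ --> X](@sqrtr0 R); apply: continuous_cvg; first exact: sqrt_continuous.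
  rewrite (_ : (fun n => inner _ _ _) = (fun n => theta p n.+1 - fine (mu perc))); last first.
    by apply/funext => n; rewrite inner_u_sub.
  rewrite -[X in _ --> X](subrr (fine (mu perc))); apply: cvgB; last exact: cvg_cst.
  by rewrite (cvg_shiftS (theta p)); exact: theta_cvg.
- apply/(cvg_Lnorm2 (fun n => L2_sub (Lg n.+1) L0)).
  rewrite -[X in _ --> X](@sqrtr0 R); apply: continuous_cvg; first exact: sqrt_continuous.
  have E n : inner mu (local_generator p (u n.+1) \- (fun e => 0 * f e))
     (local_generator p (u n.+1) \- (fun e => 0 * f e)) =
     inner mu (local_generator p (u n.+1)) (local_generator p (u n.+1)).
    by apply: eq_Rintegral => e _ /=; rewrite mul0r subr0.
  apply/cvgrPdist_le => eps eps0.
  have eps2 : 0 < eps / 2 by rewrite divr_gt0.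
  have [C C0 HC] := inner_local_generator_conn p_gt0 p_lt1 eps2.
  have : C * (theta p n - theta p n.+1) @[n --> \oo] --> (0 : R).
    rewrite -[X in _ --> X](_ : C * (fine (mu perc) - fine (mu perc)) = 0); last first.
      by rewrite subrr mulr0.
    apply: cvgM; first exact: cvg_cst.
    apply: cvgB; first exact: theta_cvg.
    by rewrite (cvg_shiftS (theta p)); exact: theta_cvg.
  move=> /cvgrPdist_le /(_ _ eps2); apply: filterS => n.
  rewrite !sub0r !normrN E => Hn; rewrite ger0_norm ?inner_ge0//.
  apply: le_trans (HC n) _; rewrite [leRHS]splitr lerD2l.
  exact: le_trans (ler_norm _) Hn.
Qed.

Lemma generator_cst : generator p (fun=> 1) (fun e => 0 * 1).
Proof.
have LE : local_generator p (fun=> 1 : R) = (fun=> 0).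
  apply/funext => e; rewrite (@local_generatorE R p [::])// ?big_nil//.
split; [exact: L2_cst|exact: L2_cst|].
exists (fun _ _ => 1); split.
- by move=> _; exists [::].
- rewrite (_ : EFin \o _ = cst 0%E) ?Lnorm0//; first exact: cvg_cst.
  by apply/funext => e /=; rewrite subrr.
- rewrite (_ : EFin \o _ = cst 0%E) ?Lnorm0//; first exact: cvg_cst.
  by apply/funext => e /=; rewrite LE mul0r subrr.
Qed.

Let integral_ae_cst (g : Omega -> R) (a : R) : measurable_fun setT g ->
  {ae mu, forall e, g e = a} -> \int[mu]_e g e = a.
Proof.
move=> mg ga; rewrite /Rintegral (ae_eq_integral (cst a%:E))//.
- rewrite integral_cst// [X in (_ * X)%E](probability_setT mu) mule1//.
- exact/measurable_EFinP.
- by apply: filterS ga => e /= ->.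
Qed.

(** Otherwise percolation has probability strictly between 0 and 1, while [1] and its indicator are
    multiples of one eigenfunction, so that the indicator is almost everywhere constant. *)
Theorem theta_small_of_simple : simple_eigenvalue p 0 ->
  forall eps : R, 0 < eps -> exists n, theta p n <= eps.
Proof.
case=> h [_ _ hs] eps eps0; apply: contrapT => H.
have theta_gt n : eps < theta p n.
  by rewrite ltNge; apply/negP => Hn; apply: H; exists n.
set k := fine (mu perc).
have k_ge : eps <= k.
  apply: (@ler_cvg_to nat \oo _ _ (cst eps) (theta p)); first exact: cvg_cst.
    exact: theta_cvg.
  by apply: nearW => n; exact: ltW.
(* Percolation requires the origin to be occupied, which has probability [p]. *)
have k_lt : k < 1.
  apply: (@le_lt_trans _ _ (theta p 0)); last first.
    rewrite /theta (_ : triangle 0 = [:: (0 : site)])// avg_cons site_meanE.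
    by rewrite /conn /= /update ?eqxx /= mulr1 mulr0 addr0.
  rewrite thetaE /k fine_le ?fin_num_measure//.
  apply: le_measure; rewrite ?inE//.
  by move=> e /= /(_ 0%N).
have [c1 H1] := hs _ generator_cst; have [c2 H2] := hs _ generator_percolation.
have c1n0 : c1 != 0.
  apply/eqP => c10; have : \int[mu]_e (fun=> 1 : R) e = 0.
    apply: integral_ae_cst => //; apply: filterS H1 => e /= ->.
    by rewrite c10 mul0r.
  rewrite (integral_ae_cst (a := 1))//; last exact: nearW.
  by move/eqP; rewrite oner_eq0.
have fc : {ae mu, forall e, f e = c2 / c1}.
  apply: filterS2 H1 H2 => e /= h1 ->.
  by rewrite -[c2 / c1]mulr1 h1 mulrA mulfVK.
have k1 : k = c2 / c1 by rewrite -(integral_ae_cst measurable_f fc) integral_f.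
have k2 : k = k * k.
  rewrite -[LHS]integral_f -(@integral_ae_cst (fun e => f e * f e) (k * k)).
  - by apply: eq_Rintegral => e _; rewrite /f indicE; case: (_ \in _); rewrite ?mulr1 ?mulr0.
  - exact: measurable_funM.
  - by apply: filterS fc => e ->; rewrite -k1.
move: k2 k_ge k_lt eps0; nra.
Qed.

End simple_zero.

Theorem theorem4 (R : realType) (p : R) (p_ge0 : 0 <= p)
    (p_lt : p < critical_density R) :
  (0 < spectral_gap p)%E.
Proof.
(* The supremum of the empty set is 0 by convention, which [0 <= p < critical_density R]
   excludes. *)
have nonempty : [set s : R | 0 <= s < 1 /\ simple_eigenvalue s 0] !=set0.
  apply/set0P/eqP => E.
  by move: (le_lt_trans p_ge0 p_lt); rewrite /critical_density E sup0 ltxx.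
have [s [/andP[s0 s1] simple_s] ps] := sup_gt nonempty p_lt.
have p1 := lt_trans ps s1.
have p01 : 0 <= p <= 1 by rewrite p_ge0 ltW.
have small := theta_subcritical p_ge0 ps (ltW s1)
  (theta_small_of_simple (le_lt_trans p_ge0 ps) s1 simple_s).
have [n [C C0 HC]] := finite_volume_poincare p_ge0 p1 small.
apply: (spectral_gap_gt0 C0) => f [s' fs'].
pose S := undup s'.
have fS : depends_on S f by apply: depends_on_sub fs' => x; rewrite mem_undup.
have uS : uniq S by exact: undup_uniq.
(* The volume contains the neighbours read by the Dirichlet form and the translates of the triangle
   required by the Poincare inequality. *)
pose M := S ++ map right_of S ++ map up_of S ++ [seq x + v | x <- S, v <- triangle n].
pose o : Omega := fun=> false.
have SM : {subset S <= M} by move=> x xS; rewrite mem_cat xS.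
rewrite (var_local p01 o (depends_on_sub SM fS)).
rewrite (@dirichlet_local R p p01 S M f o uS fS SM); last first.
  by move=> x xS; rewrite !mem_cat !map_f ?orbT.
apply: HC => // x xS v vn; rewrite !mem_cat.
by rewrite (allpairs_f (fun x v => x + v))// !orbT.
Qed.
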